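(* Let $n\ge 5$. Any $n$-dimensional complex nilpotent algebra of level two is isomorphic to one of the following algebras, each given by its nonzero products in a basis $e_1,\dots,e_n$: \begin{align*} n_{5,1}\oplus \mathfrak{a}_{n-5} &: \quad e_1e_2=e_5,\quad e_3e_4=e_5,\quad e_2e_1=-e_5,\quad e_4e_3=-e_5;\\ n_{5,2}\oplus \mathfrak{a}_{n-5} &: \quad e_1e_2=e_4,\quad e_1e_3=e_5,\quad e_2e_1=-e_4,\quad e_3e_1=-e_5;\\ L_4(\alpha)\oplus \mathfrak{a}_{n-3} &: \quad e_1e_1=e_3,\quad e_2e_2=\alpha e_3,\quad e_1e_2=e_3 \qquad (\text{for some } \alpha\in\mathbb{C});\\ L_5\oplus \mathfrak{a}_{n-3} &: \quad e_1e_1=e_3,\quad e_1e_2=e_3,\quad e_2e_1=e_3. \end{align*}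
   Context: An $n$-dimensional complex algebra is an $n$-dimensional complex vector space $V$ with a bilinear (not necessarily associative) multiplication $\lambda\in\mathrm{Hom}(V\otimes V,V)$; the set of these is $\mathrm{Alg}_n(\mathbb{C})$, an affine space with the Zariski topology. $GL_n(\mathbb{C})$ acts by $(g*\lambda)(x,y)=g(\lambda(g^{-1}(x),g^{-1}(y)))$; the orbit $\mathrm{Orb}(\lambda)$ is the set of multiplications isomorphic to $\lambda$. We say $\lambda$ degenerates to $\mu$, written $\lambda\to\mu$, if $\mathrm{Orb}(\mu)\subseteq\overline{\mathrm{Orb}(\lambda)}$ (Zariski closure). The degeneration is trivial if $\lambda\simeq\mu$, and direct if it is non-trivial and there is no $\nu$ (isomorphic to neither $\lambda$ nor $\mu$) with $\lambda\to\nu\to\mu$. The level of $\lambda$ is the maximum length of a chain of direct degenerations from $\lambda$ to the abelian algebra of dimension $n$ (the one with zero multiplication). An algebra $A$ is nilpotent if for some $m$ all products of $m$ elements of $A$, with any arrangement of brackets, vanish. No identity (associativity, Jacobi, Leibniz, ...) is assumed. $\mathfrak{a}_m$ denotes the $m$-dimensional abelian algebra (zero multiplication). In multiplication tables, products of basis elements that are not listed are zero. *)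

(* Defs.v *)
From mathcomp Require Import all_boot all_order all_algebra.
From mathcomp Require Import classical_sets reals complex.
From mathcomp Require mpoly.

Set Implicit Arguments.
Unset Strict Implicit.
Unset Printing Implicit Defensive.

Import GRing.Theory.
Local Open Scope ring_scope.
Local Open Scope classical_set_scope.

(* A multiplication on K^n is given by its structure constants: [lam (i, j, k)]
   is the coefficient of e_k in the product e_i e_j. This identifies Alg_n(K)
   with the affine space of dimension n^3. *)
Definition alg (K : fieldType) (n : nat) : Type :=
  {ffun 'I_n * 'I_n * 'I_n -> K}.

Section Algebras.
Variables (K : fieldType) (n : nat).
Implicit Types (lam mu nu : alg K n) (g : 'M[K]_n) (x y : 'cV[K]_n).

Definition alg_mul lam x y : 'cV[K]_n :=
  \col_k \sum_i \sum_j x i 0 * y j 0 * lam (i, j, k).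

(* The multiplication agreeing with [f] on pairs of standard basis vectors. *)
Definition alg_of (f : 'cV[K]_n -> 'cV[K]_n -> 'cV[K]_n) : alg K n :=
  [ffun ijk => f (delta_mx ijk.1.1 0) (delta_mx ijk.1.2 0) ijk.2 0].

Definition gl_act g lam : alg K n :=
  alg_of (fun x y => g *m alg_mul lam (invmx g *m x) (invmx g *m y)).

Definition gl_orbit lam : set (alg K n) :=
  [set mu | exists2 g, g \in unitmx & mu = gl_act g lam].

Definition isomorphic lam mu : Prop := gl_orbit lam mu.

Definition coord_poly : Type :=
  mpoly.mpoly #|{: 'I_n * 'I_n * 'I_n}| K.

Definition poly_at (p : coord_poly) lam : K :=
  mpoly.meval (fun i => lam (enum_val i)) p.

Definition zariski_closed (Z : set (alg K n)) : Prop :=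
  exists I : set coord_poly,
    Z = [set lam | forall p, I p -> poly_at p lam = 0].

Definition zariski_closure (S : set (alg K n)) : set (alg K n) :=
  smallest zariski_closed S.

Definition degenerates lam mu : Prop :=
  gl_orbit mu `<=` zariski_closure (gl_orbit lam).

Definition direct_degeneration lam mu : Prop :=
  [/\ degenerates lam mu, ~ isomorphic lam mu
    & ~ exists nu, [/\ ~ isomorphic nu lam, ~ isomorphic nu mu,
                       degenerates lam nu & degenerates nu mu]].

Definition abelian_alg : alg K n := [ffun=> 0].

(* The length of a chain is its number of degenerations. *)
Definition direct_chain lam mu (k : nat) : Prop :=
  exists c : nat -> alg K n,
    [/\ c 0%N = lam, c k = mu
      & forall i, (i < k)%N -> direct_degeneration (c i) (c i.+1)].

Definition has_level lam (k : nat) : Prop :=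
  direct_chain lam abelian_alg k /\
  forall m, direct_chain lam abelian_alg m -> (m <= k)%N.

Inductive bracketing : Type :=
| Factor of 'cV[K]_n
| Bracket of bracketing & bracketing.

Fixpoint nfactors (t : bracketing) : nat :=
  match t with
  | Factor _ => 1%N
  | Bracket t1 t2 => (nfactors t1 + nfactors t2)%N
  end.

Fixpoint bracket_value lam (t : bracketing) : 'cV[K]_n :=
  match t with
  | Factor x => x
  | Bracket t1 t2 => alg_mul lam (bracket_value lam t1) (bracket_value lam t2)
  end.

(* There is no product of zero factors, so [m = 0] must be excluded: it would
   make every algebra nilpotent. *)
Definition nilpotent_alg lam : Prop :=
  exists2 m, (0 < m)%N &
    forall t : bracketing, nfactors t = m -> bracket_value lam t = 0.

(* Basis vectors are numbered from 1; [e_ k] is zero when k is not in [1, n]. *)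
Definition e_ (k : nat) : 'cV[K]_n := \col_i (i.+1 == k)%:R.

(* [f i j] is the product e_i e_j, for i and j from 1 to n. *)
Definition table (f : nat -> nat -> 'cV[K]_n) : alg K n :=
  [ffun ijk => f (val ijk.1.1).+1 (val ijk.1.2).+1 ijk.2 0].

Definition n51 : alg K n := table (fun i j =>
  match i, j with
  | 1, 2 => e_ 5
  | 3, 4 => e_ 5
  | 2, 1 => - e_ 5
  | 4, 3 => - e_ 5
  | _, _ => 0
  end).

Definition n52 : alg K n := table (fun i j =>
  match i, j with
  | 1, 2 => e_ 4
  | 1, 3 => e_ 5
  | 2, 1 => - e_ 4
  | 3, 1 => - e_ 5
  | _, _ => 0
  end).

Definition L4 (alpha : K) : alg K n := table (fun i j =>
  match i, j with
  | 1, 1 => e_ 3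
  | 2, 2 => alpha *: e_ 3
  | 1, 2 => e_ 3
  | _, _ => 0
  end).

Definition L5 : alg K n := table (fun i j =>
  match i, j with
  | 1, 1 => e_ 3
  | 1, 2 => e_ 3
  | 2, 1 => e_ 3
  | _, _ => 0
  end).

Lemma alg_mul_alg_of f :
    (forall a x x' y, f (a *: x + x') y = a *: f x y + f x' y) ->
    (forall a x y y', f x (a *: y + y') = a *: f x y + f x y') ->
  forall x y, alg_mul (alg_of f) x y = f x y.
Proof.
move=> fl fr x y.
have f0l z : f 0 z = 0.
  by have := fl (-1) 0 0 z; rewrite scaler0 addr0 scaleN1r addNr.
have f0r z : f z 0 = 0.
  by have := fr (-1) z 0 0; rewrite scaler0 addr0 scaleN1r addNr.
have cvE (z : 'cV[K]_n) : z = \sum_i z i 0 *: delta_mx i 0.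
  by rewrite {1}[z]matrix_sum_delta; apply: eq_bigr => i _; rewrite big_ord1.
have suml (r : seq 'I_n) (a : 'I_n -> K) z :
    f (\sum_(i <- r) a i *: delta_mx i 0) z
    = \sum_(i <- r) a i *: f (delta_mx i 0) z.
  by elim: r => [|i r IH]; rewrite ?big_nil ?big_cons ?f0l // fl IH.
have sumr (r : seq 'I_n) (a : 'I_n -> K) z :
    f z (\sum_(i <- r) a i *: delta_mx i 0)
    = \sum_(i <- r) a i *: f z (delta_mx i 0).
  by elim: r => [|i r IH]; rewrite ?big_nil ?big_cons ?f0r // fr IH.
apply/colP => k; rewrite [in RHS](cvE x) suml summxE mxE; apply: eq_bigr => i _.
rewrite [in RHS](cvE y) sumr mxE summxE mulr_sumr; apply: eq_bigr => j _.
by rewrite ffunE !mxE mulrA.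
Qed.

Lemma alg_mul_linear_l lam a x x' y :
  alg_mul lam (a *: x + x') y = a *: alg_mul lam x y + alg_mul lam x' y.
Proof.
apply/colP => k; rewrite !mxE mulr_sumr -big_split; apply: eq_bigr => i _ /=.
rewrite mulr_sumr -big_split; apply: eq_bigr => j _ /=.
by rewrite !mxE !mulrDl !mulrA.
Qed.

Lemma alg_mul_linear_r lam a x y y' :
  alg_mul lam x (a *: y + y') = a *: alg_mul lam x y + alg_mul lam x y'.
Proof.
apply/colP => k; rewrite !mxE mulr_sumr -big_split; apply: eq_bigr => i _ /=.
rewrite mulr_sumr -big_split; apply: eq_bigr => j _ /=.
by rewrite !mxE mulrDr mulrDl !mulrA [x i 0 * a]mulrC.
Qed.

Lemma alg_mul_act g lam x y :
  alg_mul (gl_act g lam) x y = g *m alg_mul lam (invmx g *m x) (invmx g *m y).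
Proof.
apply: alg_mul_alg_of => [a u u' v|a u v v'].
  by rewrite mulmxDr -scalemxAr alg_mul_linear_l mulmxDr -scalemxAr.
by rewrite mulmxDr -scalemxAr alg_mul_linear_r mulmxDr -scalemxAr.
Qed.

End Algebras.

Arguments n51 {K n}.
Arguments n52 {K n}.
Arguments L4 {K n} alpha.
Arguments L5 {K n}.

(* Main.v *)
Require Import Defs.
From mathcomp Require Import all_boot all_order all_algebra.
From mathcomp Require Import boolp classical_sets reals complex.
From mathcomp Require Import(canonicals) mpoly.
From mathcomp Require Import ring.

(** An algebra lam of level two starts a chain lam -> nu -> 0 of direct degenerations. Nilpotency is a
    closed condition, so nu is nilpotent; a nonzero nilpotent algebra degenerates to lam2 (given by
    e_1 e_1 = e_2) or to n3 (given by e_1 e_2 = e_3 = - e_2 e_1), and directness of nu -> 0 makes nu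
    isomorphic to one of them, T. Directness of lam -> T then says: if lam -> T' -> T and T' is
    not isomorphic to T, then lam is isomorphic to T'. It remains to find one of the listed algebras
    between lam and T.

    All degenerations come from weighted one-parameter subgroups (degenerates_weights). In particular
    a nonzero linear form phi vanishing on independent vectors x_1, .., x_d yields a degeneration of lam to the
    algebra of the bilinear form phi (x_i x_j) with values on a line (degenerates_form).

    If lam is anticommutative, then T is n3. When some x has two independent products x y, x z, one can
    choose y and z so that x, y, z, x y, x z are independent, which leads to n52; otherwise lam is an
    alternating form with values on a line and either is n3, which is excluded, or leads to n51
    (anti_iso_n3_or_degenerates).

    If lam is not anticommutative, consider the forms on planes obtained from phi; a form that is
    neither symmetric nor alternating leads to L4 al, where al is the determinant divided by the
    square of the skew part, and a nondegenerate symmetric form leads to L5. When T is lam2, these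
    algebras degenerate to T. If none of them is reached, the form on a generic plane, hence
    on every plane, is symmetric of rank at most one, and nilpotency forces lam to be lam2
    (iso_lam2), which is excluded. When T is n3, the ratio that defines al equals 1/4 at T. Were it
    constant on the orbit of lam, it would be 1/4; and if it is not constant, it takes infinitely many
    values. Either way lam degenerates to L4 (1/4), which lies above n3 (degenerates_n3_L4).

    Genericity arguments run along lines in the space of matrices: there the adjugate makes all
    structure constants polynomial in the parameter (orbit_line), and polynomials in one variable
    suffice. *)

Set Implicit Arguments.
Unset Strict Implicit.
Unset Printing Implicit Defensive.

Import GRing.Theory Num.Theory.
Local Open Scope ring_scope.

(** * Bilinearity, base change and isomorphism *)

Section Bilinear.
Variables (K : fieldType) (n : nat).
Implicit Types (lam mu nu : alg K n) (x y z : 'cV[K]_n).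

Lemma algM0l lam y : alg_mul lam 0 y = 0.
Proof.
by have := alg_mul_linear_l lam (-1) 0 0 y; rewrite scaler0 addr0 scaleN1r addNr.
Qed.

Lemma algM0r lam x : alg_mul lam x 0 = 0.
Proof.
by have := alg_mul_linear_r lam (-1) x 0 0; rewrite scaler0 addr0 scaleN1r addNr.
Qed.

Lemma algMDl lam x x' y :
  alg_mul lam (x + x') y = alg_mul lam x y + alg_mul lam x' y.
Proof. by have := alg_mul_linear_l lam 1 x x' y; rewrite !scale1r. Qed.

Lemma algMDr lam x y y' :
  alg_mul lam x (y + y') = alg_mul lam x y + alg_mul lam x y'.
Proof. by have := alg_mul_linear_r lam 1 x y y'; rewrite !scale1r. Qed.

Lemma algMZl lam a x y : alg_mul lam (a *: x) y = a *: alg_mul lam x y.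
Proof. by have := alg_mul_linear_l lam a x 0 y; rewrite !(addr0, algM0l). Qed.

Lemma algMZr lam a x y : alg_mul lam x (a *: y) = a *: alg_mul lam x y.
Proof. by have := alg_mul_linear_r lam a x y 0; rewrite !(addr0, algM0r). Qed.

Lemma algMNl lam x y : alg_mul lam (- x) y = - alg_mul lam x y.
Proof. by rewrite -!scaleN1r algMZl. Qed.

Lemma algMNr lam x y : alg_mul lam x (- y) = - alg_mul lam x y.
Proof. by rewrite -!scaleN1r algMZr. Qed.

Definition algME :=
  (algMDl, algMDr, algMZl, algMZr, algMNl, algMNr, algM0l, algM0r).

Lemma algM_delta lam i j k :
  alg_mul lam (delta_mx i 0) (delta_mx j 0) k 0 = lam (i, j, k).
Proof.
rewrite mxE (bigD1 i) //= (bigD1 j) //= !mxE !eqxx !mul1r.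
rewrite big1 => [|j' /negPf ne]; last by rewrite !mxE ne mulr0 mul0r.
rewrite big1 ?addr0 // => i' /negPf ne.
by apply: big1 => j' _; rewrite !mxE ne !mul0r.
Qed.

Lemma algM_eq0 lam :
  (forall x y, alg_mul lam x y = 0) -> lam = abelian_alg K n.
Proof.
by move=> h; apply/ffunP => -[[i j] k]; rewrite ffunE -algM_delta h mxE.
Qed.

Lemma algM_abelian x y : alg_mul (abelian_alg K n) x y = 0.
Proof.
apply/colP => k; rewrite !mxE; apply: big1 => i _; apply: big1 => j _.
by rewrite ffunE mulr0.
Qed.

End Bilinear.

Section Orbits.
Variables (K : fieldType) (n : nat).
Implicit Types (lam mu nu : alg K n) (x y z : 'cV[K]_n) (g h B : 'M[K]_n).

Lemma alg_ext lam mu :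
  (forall x y, alg_mul lam x y = alg_mul mu x y) -> lam = mu.
Proof.
by move=> e; apply/ffunP => -[[i j] k]; rewrite -!algM_delta e.
Qed.

Lemma gl_act1 lam : gl_act 1%:M lam = lam.
Proof. by apply: alg_ext => x y; rewrite alg_mul_act invmx1 !mul1mx. Qed.

Lemma gl_actM g h lam : g \in unitmx -> h \in unitmx ->
  gl_act g (gl_act h lam) = gl_act (g *m h) lam.
Proof.
move=> ug uh; apply: alg_ext => x y; rewrite !alg_mul_act.
have <- : invmx h *m invmx g = invmx (g *m h).
  rewrite -[RHS]mul1mx.
  apply: (canRL (mulmxK _)); first by rewrite unitmx_mul ug.
  by rewrite -mulmxA (mulmxA _ g) mulVmx // mul1mx mulVmx.
by rewrite !mulmxA.
Qed.

Lemma iso_refl lam : isomorphic lam lam.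
Proof. by exists 1%:M; rewrite ?unitmx1 ?gl_act1. Qed.

Lemma iso_sym lam mu : isomorphic lam mu -> isomorphic mu lam.
Proof.
case=> g ug ->; exists (invmx g); first by rewrite unitmx_inv.
by rewrite gl_actM ?unitmx_inv // mulVmx // gl_act1.
Qed.

Lemma iso_trans lam mu nu :
  isomorphic lam mu -> isomorphic mu nu -> isomorphic lam nu.
Proof.
case=> g ug ->; case=> h uh ->; exists (h *m g); first by rewrite unitmx_mul uh.
by rewrite gl_actM.
Qed.

Lemma iso_abelian lam : isomorphic lam (abelian_alg K n) -> lam = abelian_alg K n.
Proof.
move/iso_sym => -[g ug ->]; apply: algM_eq0 => x y.
by rewrite alg_mul_act algM_abelian mulmx0.
Qed.

(** The structure constants of lam in the basis formed by the columns of B. *)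
Definition sconst lam B : alg K n := gl_act (invmx B) lam.

Lemma sconstE lam B i j k : B \in unitmx ->
  sconst lam B (i, j, k)
  = (row k (invmx B) *m alg_mul lam (col i B) (col j B)) 0 0.
Proof.
move=> uB; rewrite -algM_delta alg_mul_act invmxK -!colE.
by rewrite !mxE; apply: eq_bigr => l _; rewrite !mxE.
Qed.

Lemma iso_sconst lam B : B \in unitmx -> isomorphic lam (sconst lam B).
Proof. by move=> uB; exists (invmx B); rewrite ?unitmx_inv. Qed.

End Orbits.

(** * Regular functions and Zariski closures of orbits *)

Section PolynomialFunctions.
Variables (K : fieldType) (n : nat).

(** A class of functions that contains the constants and the coordinates of Phi and is closed under
    sums and products contains every polynomial in those coordinates. It serves twice: for the
    regular functions, and for the functions of one parameter along a curve. *)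
Lemma poly_at_ind (T : Type) (A : (T -> K) -> Prop) (Phi : T -> alg K n) :
    (forall c, A (fun=> c)) ->
    (forall f g, A f -> A g -> A (fun t => f t + g t)) ->
    (forall f g, A f -> A g -> A (fun t => f t * g t)) ->
    (forall ijk, A (fun t => Phi t ijk)) ->
  forall p : coord_poly K n, A (fun t => poly_at p (Phi t)).
Proof.
move=> Ac Aa Am Ax; elim/mpoly.mpolyind => [|c m p _ _ IH].
  by rewrite /poly_at; under eq_fun do rewrite mpoly.meval0.
rewrite /poly_at; under eq_fun do rewrite mpoly.mevalD mpoly.mevalZ mpoly.mevalX.
apply: (Aa) => //; apply: (Am) => //.
elim: (index_enum _) => [|i r IHr]; first by under eq_fun do rewrite big_nil.
under eq_fun do rewrite big_cons; apply: (Am) => //.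
elim: (mpoly.fun_of_multinom m i) => [|k IHk]; first by under eq_fun do rewrite expr0.
by under eq_fun do rewrite exprS; apply: Am.
Qed.

Definition regular_fun (f : alg K n -> K) : Prop :=
  exists p : coord_poly K n, forall lam, f lam = poly_at p lam.

Lemma regular_cst c : regular_fun (fun=> c).
Proof. by exists (mpoly.mpolyC _ c) => lam; rewrite /poly_at mpoly.mevalC. Qed.

Lemma regularD f g :
  regular_fun f -> regular_fun g -> regular_fun (fun lam => f lam + g lam).
Proof.
move=> [p fp] [q gq]; exists ((p : mpoly.mpoly _ K) + q) => lam.
by rewrite /poly_at mpoly.mevalD fp gq.
Qed.

Lemma regularM f g :
  regular_fun f -> regular_fun g -> regular_fun (fun lam => f lam * g lam).
Proof.
move=> [p fp] [q gq]; exists ((p : mpoly.mpoly _ K) * q) => lam.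
by rewrite /poly_at mpoly.mevalM fp gq.
Qed.

Lemma regularN f : regular_fun f -> regular_fun (fun lam => - f lam).
Proof.
move=> rf; under eq_fun do rewrite -mulN1r.
by apply: regularM => //; apply: regular_cst.
Qed.

Lemma regular_coord ijk : regular_fun (fun lam : alg K n => lam ijk).
Proof.
exists (mpoly.mpolyX _ (mpoly.mnm1 (enum_rank ijk))) => lam.
by rewrite /poly_at mpoly.mevalXU enum_rankK.
Qed.

Lemma regular_sum (I : Type) (r : seq I) (f : I -> alg K n -> K) :
  (forall i, regular_fun (f i)) -> regular_fun (fun lam => \sum_(i <- r) f i lam).
Proof.
move=> rf; elim: r => [|i r IH].
  by under eq_fun do rewrite big_nil; apply: regular_cst.
by under eq_fun do rewrite big_cons; apply: regularD.
Qed.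

Lemma regular_algM (u v : alg K n -> 'cV[K]_n) k :
  (forall i, regular_fun (fun lam => u lam i 0)) ->
  (forall i, regular_fun (fun lam => v lam i 0)) ->
  regular_fun (fun lam => alg_mul lam (u lam) (v lam) k 0).
Proof.
move=> ru rv; under eq_fun do rewrite mxE.
apply: regular_sum => i; apply: regular_sum => j.
by apply: regularM; [apply: regularM | apply: regular_coord].
Qed.

Lemma regular_bracket (t : bracketing K n) k :
  regular_fun (fun lam => bracket_value lam t k 0).
Proof.
elim: t k => [x|t1 IH1 t2 IH2] k /=; first exact: regular_cst.
exact: regular_algM.
Qed.

Lemma regular_gl_act g (f : alg K n -> K) :
  regular_fun f -> regular_fun (fun lam => f (gl_act g lam)).
Proof.
case=> p fp; under eq_fun do rewrite fp.
apply: (poly_at_ind (A := regular_fun)).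
- exact: regular_cst.
- exact: regularD.
- exact: regularM.
case=> [[i j] k]; under eq_fun do rewrite ffunE mxE.
apply: regular_sum => l; apply: regularM; first exact: regular_cst.
by apply: regular_algM => ?; apply: regular_cst.
Qed.

Lemma poly_at_curve (P : 'I_n * 'I_n * 'I_n -> {poly K}) (p : coord_poly K n) :
  exists q : {poly K}, forall t, poly_at p [ffun ijk => (P ijk).[t]] = q.[t].
Proof.
pose A (f : K -> K) := exists q : {poly K}, forall t, f t = q.[t].
apply: (poly_at_ind (A := A)) => [c|f g [q fq] [r gr]|f g [q fq] [r gr]|ijk].
- by exists c%:P => t; rewrite hornerC.
- by exists (q + r) => t; rewrite hornerD fq gr.
- by exists (q * r) => t; rewrite hornerM fq gr.
- by exists (P ijk) => t; rewrite ffunE.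
Qed.

End PolynomialFunctions.

Section Closure.
Variables (K : fieldType) (n : nat).
Implicit Types (lam mu nu : alg K n).

Lemma closureP (S : set (alg K n)) mu :
  zariski_closure S mu <->
  forall f, regular_fun f -> (forall nu, S nu -> f nu = 0) -> f mu = 0.
Proof.
split=> [cmu f [p fp] f0|h Z [[I ->]] SZ p Ip].
  rewrite fp; apply: (cmu [set nu | poly_at p nu = 0]%classic).
    split=> [|nu /f0]; last by rewrite fp.
    exists [set p]%classic; apply/seteqP; split=> nu /=; first by move=> ? _ ->.
    exact.
by apply: h => [|nu /SZ]; [exists p | apply].
Qed.

(** It suffices to test mu itself rather than its whole orbit: acting by g is a regular map which
    preserves the orbit of lam, hence also its closure. *)
Lemma degeneratesP lam mu :
  degenerates lam mu <->
  forall f, regular_fun f -> (forall nu, isomorphic lam nu -> f nu = 0) -> f mu = 0.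
Proof.
split=> [d f rf f0|h _ [g ug ->]].
  by have /closureP := d mu (iso_refl mu); apply.
apply/closureP => f rf f0.
apply: (h (fun nu => f (gl_act g nu))) => [|nu li]; first exact: regular_gl_act.
apply: f0; apply: iso_trans li _; by exists g.
Qed.

Lemma degenerates_iso lam lam' mu mu' : isomorphic lam lam' -> isomorphic mu mu' ->
  degenerates lam mu -> degenerates lam' mu'.
Proof.
move=> il im d nu /(iso_trans im) /d /closureP h; apply/closureP => f rf f0.
by apply: h => // rho lr; apply: f0; apply: iso_trans lr; apply: iso_sym.
Qed.

Lemma degenerates_refl lam : degenerates lam lam.
Proof. by apply/degeneratesP => f _; apply; apply: iso_refl. Qed.

Lemma degenerates_of_iso lam mu : isomorphic lam mu -> degenerates lam mu.
Proof. by move=> i; exact (degenerates_iso (iso_refl lam) i (degenerates_refl (lam:=lam))). Qed.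

(** The limit of a curve lies in the closure as soon as the parameters at which the curve stays in
    the closure are too many to be roots of a nonzero polynomial. *)
Lemma degenerates_curve lam (P : 'I_n * 'I_n * 'I_n -> {poly K}) (c : K) :
    (forall q : {poly K},
       (forall t, degenerates lam [ffun ijk => (P ijk).[t]] -> root q t) -> q = 0) ->
  degenerates lam [ffun ijk => (P ijk).[c]].
Proof.
move=> inf; apply/degeneratesP => f [p fp] f0.
have [q pq] := poly_at_curve P p.
rewrite fp pq (inf q) ?horner0 // => t /degeneratesP/(_ f).
rewrite /root -pq -fp => ->//; by exists p.
Qed.

End Closure.

Section Roots.
Variable K : numFieldType.

Lemma poly0_of_roots (p : {poly K}) : (forall t, root p t) -> p = 0.
Proof.
move=> rp; apply/eqP/contraT => p0.
pose s : seq K := [seq i%:R | i <- iota 0 (size p)].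
have us : uniq s.
  rewrite map_inj_in_uniq ?iota_uniq // => i j _ _ /eqP.
  by rewrite eqr_nat => /eqP.
have := @max_poly_roots _ p s p0; rewrite us size_map size_iota ltnn; apply=> //.
exact/allP.
Qed.

Lemma poly0_off_roots (p d : {poly K}) :
  d != 0 -> (forall t, ~~ root d t -> root p t) -> p = 0.
Proof.
move=> d0 rp; apply/eqP; have /eqP : d * p = 0.
  apply: poly0_of_roots => t; rewrite rootM.
  by case: (boolP (root d t)) => //= /rp.
by rewrite mulf_eq0 (negPf d0).
Qed.

Lemma exists_nonroot (d : {poly K}) : d != 0 -> exists t, ~~ root d t.
Proof.
move=> d0; apply: contrapT => h; move/eqP: d0; apply; apply: poly0_of_roots => t.
by apply: contrapT => /negP r; apply: h; exists t.
Qed.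

End Roots.

(** * Bases extending a given family *)

Section Bases.
Variables (K : fieldType) (n : nat).
Implicit Types (x y z u v : 'cV[K]_n) (B : 'M[K]_n) (X : seq 'cV[K]_n) (F : seq 'rV[K]_n).

(** A basis of a complement of the span of X supplies the missing columns. *)
Lemma free_completion X : free X ->
  exists2 B, B \in unitmx & forall i : 'I_n, (i < size X)%N -> col i B = X`_i.
Proof.
move=> fX; pose C := (<<X>>^C)%VS; pose Y := X ++ vbasis C.
have fC : free (vbasis C) by apply: basis_free (vbasisP C).
have eC : <<vbasis C>>%VS = C by apply: span_basis; exact: vbasisP.
have fY : free Y.
  by rewrite cat_free fX fC eC; apply/directv_addP; rewrite capv_compl.
have sY : size Y == n.
  rewrite size_cat size_tuple; move: fX; rewrite /free => /eqP <-.
  rewrite -dimv_disjoint_sum ?capv_compl // addv_complf dimvf dim_matrix.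
  by apply/eqP; exact: muln1.
pose B : 'M[K]_n := \matrix_(i, j) (Y`_j) i 0.
have colB j : col j B = Y`_j by apply/colP => i; rewrite !mxE.
exists B => [|i ltiX]; last by rewrite colB nth_cat ltiX.
rewrite -unitmx_tr -row_free_unit -kermx_eq0; apply/rowV0P => v /sub_kermxP vB.
have /freeP fT : free (Tuple sY) by [].
have e0 : \sum_(j < n) v 0 j *: (Tuple sY)`_j = 0.
  apply/colP => i; have /rowP/(_ i) := vB; rewrite !mxE summxE => e.
  by rewrite -[RHS]e; apply: eq_bigr => j _; rewrite !mxE.
by apply/rowP => j; rewrite (fT (fun j => v 0 j) e0) mxE.
Qed.

(** The rows F are the coordinate forms of the vectors X on their span, but they are also prescribed
    outside that span; this is how one fixes the coefficient of a product that has to be read off. *)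
Definition dual_families F X :=
  size F = size X /\
  forall a b, (a < size X)%N -> (b < size X)%N -> (F`_a *m X`_b) 0 0 = (a == b)%:R.

Lemma dual_free F X : dual_families F X -> free X.
Proof.
case=> _ d; apply/(@freeP _ _ _ (in_tuple X)) => k k0 i.
have := congr1 (fun v => (F`_i *m v) 0 0) k0.
rewrite mulmx0 [RHS]mxE mulmx_sumr summxE (bigD1 i) //= big1 => [|j ji].
  by rewrite addr0 -scalemxAr mxE d // eqxx mulr1.
by rewrite -scalemxAr mxE d // eq_sym (inj_eq val_inj) (negPf ji) mulr0.
Qed.

Lemma free_size X : free X -> (size X <= n)%N.
Proof.
rewrite /free => /eqP <-; have := dimvS (subvf <<X>>%VS).
by rewrite dimvf dim_matrix (_ : (n * 1)%R = n) //; exact: muln1.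
Qed.

(** An arbitrary completion B0 of X is corrected by subtracting from each further column the
    combination of X that F sees in it. In matrix form this is B0 (1 - N) with N of square zero, so
    the corrected matrix is still invertible. *)
Lemma dual_completion F X : dual_families F X ->
  exists2 B, B \in unitmx &
    (forall i : 'I_n, (i < size X)%N -> col i B = X`_i) /\
    (forall i : 'I_n, (i < size X)%N -> row i (invmx B) = F`_i).
Proof.
move=> dFX; have fX := dual_free dFX; case: dFX => sF d.
have [B0 uB0 cB0] := free_completion fX.
have sX := free_size fX.
pose N : 'M[K]_n := \matrix_(a, k)
  (if (a < size X)%N then (F`_a *m col k B0) 0 0 - (a == k)%:R else 0).
have N0 (k : 'I_n) (a : 'I_n) : (k < size X)%N -> N a k = 0.
  move=> kX; rewrite mxE; case: ifP => // aX.
  by rewrite cB0 // d // subrr.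
have NN : N *m N = 0.
  apply/matrixP => a k; rewrite !mxE big1 // => l _.
  case: (ltnP l (size X)) => lX; first by rewrite N0 ?mul0r.
  by rewrite [N l k]mxE ltnNge lX mulr0.
(* The inverse of 1 - N is 1 + N. *)
have u1 : (1%:M - N) \in unitmx.
  have : (1%:M - N) *m (1%:M + N) = 1%:M.
    by rewrite mulmxDr mulmx1 mulmxBl mul1mx NN subr0 subrK.
  by case/mulmx1_unit.
have uB : B0 *m (1%:M - N) \in unitmx by rewrite unitmx_mul uB0.
exists (B0 *m (1%:M - N)) => //; split=> i iX.
  rewrite mulmxBr mulmx1 -cB0 //; apply/colP => k; rewrite !mxE.
  by rewrite big1 ?subr0 // => l _; rewrite N0 ?mulr0.
rewrite rowE; apply: (canLR (mulmxK uB)); apply/rowP => k.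
have FE l : (F`_i *m B0) 0 l = (F`_i *m col l B0) 0 0.
  by rewrite !mxE; apply: eq_bigr => ? _; rewrite !mxE.
rewrite mulmxA mulmxBr mulmx1; move: (F`_i *m B0) FE => A FE.
have -> : (A - A *m N) 0 k = A 0 k - \sum_l A 0 l * N l k by rewrite !mxE.
rewrite (bigD1 i) //= big1 => [|l li].
  rewrite addr0 [A 0 i]FE cB0 // d // eqxx mul1r [N i k]mxE iX -FE opprB addrC subrK.
  by rewrite mxE eqxx eq_sym.
case: (ltnP l (size X)) => lX; last by rewrite [N l k]mxE ltnNge lX mulr0.
by rewrite FE cB0 // d // eq_sym (inj_eq val_inj) (negPf li) mul0r.
Qed.

Lemma free_dual X : free X -> exists F, dual_families F X.
Proof.
move=> fX; have [B uB cB] := free_completion fX.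
exists [seq (if insub a is Some i then row i (invmx B) else 0)
       | a <- iota 0 (size X)]; split=> [|a b aX bX]; first by rewrite size_map size_iota.
have sX := free_size fX.
pose i := Ordinal (leq_trans aX sX); pose j := Ordinal (leq_trans bX sX).
rewrite (nth_map 0%N) ?size_iota // nth_iota // add0n insubT ?(leq_trans aX) //= => lt_an.
have -> : X`_b = col j B by rewrite cB.
rewrite (_ : Sub a lt_an = i); last exact: val_inj.
by rewrite -row_mul colE mulmxA mulVmx // mul1mx !mxE andbT -(inj_eq val_inj).
Qed.

End Bases.

(** * Degenerations along one-parameter subgroups *)

Section Weights.
Variables (K : numFieldType) (n : nat).
Implicit Types (lam mu nu : alg K n) (x y z : 'cV[K]_n) (B : 'M[K]_n).

Lemma iso_torus nu (w : 'I_n -> nat) (t : K) : t != 0 ->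
  isomorphic nu [ffun ijk =>
    nu ijk * t ^+ w ijk.1.1 * t ^+ w ijk.1.2 / t ^+ w ijk.2].
Proof.
move=> t0; pose g : 'M[K]_n := diag_mx (\row_i (t ^+ w i)^-1).
have tn0 i : t ^+ w i != 0 by rewrite expf_neq0.
have ug : g \in unitmx.
  rewrite unitmxE det_diag unitfE; apply/prodf_neq0 => i _.
  by rewrite mxE invr_neq0.
have gd i : invmx g *m delta_mx i 0 = t ^+ w i *: (delta_mx i 0 : 'cV[K]_n).
  apply: (canLR (mulKmx ug)); rewrite -scalemxAr mul_diag_mx.
  apply/colP => k; rewrite !mxE; case: eqP => [->|]; last by rewrite !mulr0.
  by rewrite mulr1 mulfV.
exists g => //; apply/ffunP => -[[i j] k].
rewrite !ffunE /= !gd !algME -!scalemxAr mul_diag_mx !mxE -(algM_delta nu) mxE.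
by ring.
Qed.

(** In the basis rescaled by t ^ w_i the structure constant (i, j, k) is multiplied by
    t ^ (w_i + w_j - w_k). Under the first hypothesis no negative power of t occurs, and at t = 0
    only the constants with w_k = w_i + w_j survive. *)
Lemma degenerates_weights lam mu B (w : 'I_n -> nat) : B \in unitmx ->
    (forall i j k, (w i + w j < w k)%N -> sconst lam B (i, j, k) = 0) ->
    (forall i j k, mu (i, j, k) =
       if w k == (w i + w j)%N then sconst lam B (i, j, k) else 0) ->
  degenerates lam mu.
Proof.
move=> uB w0 muE; have := iso_sconst lam uB; move: (sconst lam B) w0 muE.
move=> nu w0 muE il; apply: (degenerates_iso (iso_sym il) (iso_refl mu)).
pose P ijk : {poly K} :=
  (nu ijk)%:P * 'X^(w ijk.1.1 + w ijk.1.2 - w ijk.2).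
have -> : mu = [ffun ijk => (P ijk).[0]].
  apply/ffunP => -[[i j] k]; rewrite ffunE hornerM hornerC hornerXn /= muE.
  rewrite expr0n subn_eq0; case: ltngtP => [/w0 ->|lt|e].
  - by rewrite mul0r.
  - by rewrite mulr0.
  - by rewrite mulr1.
apply: degenerates_curve => q rq.
apply: (@poly0_off_roots _ _ 'X) => [|t]; first by rewrite polyX_eq0.
rewrite /root hornerX => t0; apply: rq.
have := @degenerates_of_iso _ _ _ _ (iso_torus nu w t0); congr degenerates.
apply/ffunP => -[[i j] k]; rewrite !ffunE /= hornerM hornerC hornerXn.
case: (ltnP (w i + w j) (w k)) => [/w0 ->|le]; first by rewrite !mul0r.
by rewrite expfB_cond ?(negPf t0) // exprD; ring.
Qed.

Lemma degenerates_abelian lam : degenerates lam (abelian_alg K n).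
Proof.
apply: (@degenerates_weights _ _ 1%:M (fun=> 1%N)); rewrite ?unitmx1 // => i j k.
by rewrite ffunE.
Qed.

(** Two-step algebras with a one-dimensional square: a bilinear form on the first d basis vectors,
    with values on the line of the next one. *)
Definition form_alg (d : nat) (b : nat -> nat -> K) : alg K n :=
  [ffun ijk : 'I_n * 'I_n * 'I_n => if [&& (ijk.1.1 < d)%N, (ijk.1.2 < d)%N & val ijk.2 == d]
               then b ijk.1.1 ijk.1.2 else 0].

Lemma eq_form_alg d b b' :
  (forall i j, (i < d)%N -> (j < d)%N -> b i j = b' i j) ->
  form_alg d b = form_alg d b'.
Proof.
by move=> e; apply/ffunP => -[[i j] k]; rewrite !ffunE /=; case: and3P => // -[? ? _]; apply: e.
Qed.

(** Sums of two weights are at least 4 and weights are at most 4, so no product obstructs the limit,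
    and only the products of two of the first d vectors with values on the next one survive. *)
Definition form_weight d (i : 'I_n) : nat :=
  if (i < d)%N then 2 else if val i == d then 4 else 3.

(** A nonzero linear form F_d that vanishes on independent vectors x_0 .. x_(d-1) turns the
    multiplication into a bilinear form on their span, and lam degenerates to the algebra of that form. *)
Lemma degenerates_form lam d F X : dual_families F X -> size X = d.+1 ->
  degenerates lam (form_alg d (fun i j => (F`_d *m alg_mul lam X`_i X`_j) 0 0)).
Proof.
move=> dFX sX; have [B uB [cB rB]] := dual_completion dFX.
apply: (@degenerates_weights _ _ B (form_weight d)) => // i j k.
  rewrite /form_weight; do ![case: ifP => //].
rewrite ffunE /= /form_weight.
case: (ltnP i d) => [id|di] /=; last by do ![case: ifP => //].
case: (ltnP j d) => [jd|dj] /=; last by do ![case: ifP => //].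
case: (ltngtP k d) => //= kd.
by rewrite sconstE // !cB ?rB ?sX ?kd // ltnS ltnW.
Qed.

(** Every nonzero nilpotent algebra degenerates to this one or to n3 below. *)
Definition lam2 : alg K n := form_alg 1 (fun _ _ => 1).
Definition form2 (a b c d : K) (i j : nat) : K :=
  if i == 0%N then if j == 0%N then a else b else if j == 0%N then c else d.

Definition n3 : alg K n := form_alg 2 (form2 0 1 (-1) 0).

Lemma L4E al : L4 al = form_alg 2 (form2 1 1 0 al) :> alg K n.
Proof.
apply/ffunP => -[[[i hi] [j hj]] [k hk]]; rewrite !ffunE /= /form2.
case: i hi => [|[|i]] hi; case: j hj => [|[|j]] hj; rewrite /= !mxE //= ?mxE ?eqSS //;
  by case: eqP => //; rewrite ?mulr1 ?mulr0.
Qed.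

Lemma L5E : L5 = form_alg 2 (form2 1 1 1 0) :> alg K n.
Proof.
apply/ffunP => -[[[i hi] [j hj]] [k hk]]; rewrite !ffunE /= /form2.
case: i hi => [|[|i]] hi; case: j hj => [|[|j]] hj; rewrite /= !mxE //= ?mxE ?eqSS //;
  by case: eqP => //; rewrite ?mulr1 ?mulr0.
Qed.

Definition symp4 (i j : nat) : K :=
  if (i < 2)%N && (j < 2)%N then form2 0 1 (-1) 0 i j else
  if (1 < i)%N && (1 < j)%N then form2 0 1 (-1) 0 (i - 2) (j - 2) else 0.

Lemma n51E : n51 = form_alg 4 symp4 :> alg K n.
Proof.
apply/ffunP => -[[[i hi] [j hj]] [k hk]]; rewrite !ffunE /= /symp4 /form2.
case: i hi => [|[|[|[|i]]]] hi; case: j hj => [|[|[|[|j]]]] hj;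
  rewrite /= ?mxE //= ?mxE ?eqSS //; by case: eqP => //; rewrite ?oppr0.
Qed.

End Weights.

Section Free.
Variables (K : fieldType) (V : vectType K).
Implicit Types (x y z u v : V).

Lemma free2P x y :
  (forall a b, a *: x + b *: y = 0 -> a = 0 /\ b = 0) <-> free [:: x; y].
Proof.
split=> [h|/(@freeP _ _ _ (in_tuple [:: x; y])) f a b e].
  apply/(@freeP _ _ _ (in_tuple [:: x; y])) => k.
  rewrite !big_ord_recl big_ord0 /= addr0 => /h [e0 e1] i.
  by case: i => [[|[]]] // hi; [rewrite -[RHS]e0 | rewrite -[RHS]e1]; congr k; apply: val_inj.
have := f (fun i => [:: a; b]`_i).
rewrite !big_ord_recl big_ord0 /= addr0 => /(_ e) h.
by split; [have := h ord0 | have := h (lift ord0 ord0)].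
Qed.

Lemma free3P x y z :
  (forall a b c, a *: x + b *: y + c *: z = 0 -> [/\ a = 0, b = 0 & c = 0]) <->
  free [:: x; y; z].
Proof.
split=> [h|/(@freeP _ _ _ (in_tuple [:: x; y; z])) f a b c e].
  apply/(@freeP _ _ _ (in_tuple [:: x; y; z])) => k.
  rewrite !big_ord_recl big_ord0 /= addr0 addrA => /h [e0 e1 e2] i.
  by case: i => [[|[|[]]]] // hi;
    [rewrite -[RHS]e0 | rewrite -[RHS]e1 | rewrite -[RHS]e2]; congr k; apply: val_inj.
have := f (fun i => [:: a; b; c]`_i).
rewrite !big_ord_recl big_ord0 /= addr0 addrA => /(_ e) h.
by split; [have := h ord0 | have := h (lift ord0 ord0) | have := h (lift ord0 (lift ord0 ord0))].
Qed.

Lemma free5 x y z u v :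
  (forall a b c d e, a *: x + b *: y + c *: z + d *: u + e *: v = 0 ->
     [/\ a = 0, b = 0, c = 0, d = 0 & e = 0]) ->
  free [:: x; y; z; u; v].
Proof.
move=> h; apply/(@freeP _ _ _ (in_tuple [:: x; y; z; u; v])) => k.
rewrite !big_ord_recl big_ord0 /= addr0 !addrA => /h [e0 e1 e2 e3 e4] i.
by case: i => [[|[|[|[|[]]]]]] // hi;
    [rewrite -[RHS]e0 | rewrite -[RHS]e1 | rewrite -[RHS]e2 | rewrite -[RHS]e3
    | rewrite -[RHS]e4]; congr k; apply: val_inj.
Qed.

End Free.

Section Criteria.
Variables (K : numFieldType) (n : nat).
Implicit Types (lam mu nu : alg K n) (x y z v : 'cV[K]_n) (B : 'M[K]_n).

Lemma free_delta (s : seq 'I_n) : uniq s ->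
  free [seq (delta_mx i 0 : 'cV[K]_n) | i <- s].
Proof.
move=> us; apply: (@dual_free _ _ [seq (delta_mx 0 i : 'rV[K]_n) | i <- s]).
split=> [|a b]; rewrite ?size_map // => aX bX.
case: s us aX bX => // i0 s us aX bX.
rewrite !(nth_map i0) // -rowE !mxE andbT.
by rewrite nth_uniq.
Qed.

Lemma degenerates_lam2 lam x : free [:: x; alg_mul lam x x] ->
  degenerates lam (lam2 K n).
Proof.
move=> fX; have [F dF] := free_dual fX.
have := @degenerates_form _ _ lam _ _ _ dF erefl.
congr degenerates; apply: eq_form_alg => -[|i] [|j] //= _ _.
by case: dF => _ /(_ 1 1)%N ->.
Qed.

Lemma row_inv_col B k l : B \in unitmx ->
  (row k (invmx B) *m col l B) 0 0 = (k == l)%:R.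
Proof. by move=> uB; rewrite -row_mul colE mulmxA mulVmx // mul1mx !mxE andbT. Qed.

Definition star_alg (m : nat) : alg K n :=
  [ffun ijk : 'I_n * 'I_n * 'I_n =>
    let i := val ijk.1.1 in let j := val ijk.1.2 in let k := val ijk.2 in
    if [&& i == 0, 0 < j, j <= m & k == j + m]%N then 1 else
    if [&& j == 0, 0 < i, i <= m & k == i + m]%N then -1 else 0].

(** For x of weight 3, the y_i of weight 4, the x y_i of weight 7 and everything else of weight 5,
    the only sum of weights below 7 is 3 + 3; it belongs to the square of x. *)
Definition star_weight (m : nat) (i : 'I_n) : nat :=
  if val i == 0%N then 3 else if (i <= m)%N then 4 else
  if (i <= m + m)%N then 7 else 5.

(** The weights are those of star_weight; products of the y_i with each other, and of anything with the remaining basis vectors, have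
    total weight at least 8 and disappear in the limit. *)
Lemma degenerates_star lam x (ys : seq 'cV[K]_n) :
    alg_mul lam x x = 0 ->
    (forall y, y \in ys -> alg_mul lam y x = - alg_mul lam x y) ->
    free (x :: ys ++ map (alg_mul lam x) ys) ->
  degenerates lam (star_alg (size ys)).
Proof.
move=> xx yx fX; have [B uB cB] := free_completion fX.
have := free_size fX; rewrite /= size_cat size_map in cB *; set m := size ys => le_n.
have cx (i : 'I_n) : val i = 0%N -> col i B = x.
  by move=> i0; rewrite cB /= i0.
have cy (i : 'I_n) : (0 < i <= m)%N -> col i B = ys`_i.-1.
  case: i => [[|i] hi] //= im; rewrite cB /= ?nth_cat ?im //.
  by rewrite ltnS (leq_trans im) // leq_addr.
have row_xy (i k : 'I_n) : (0 < i <= m)%N ->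
    (row k (invmx B) *m alg_mul lam x (col i B)) 0 0 = (val k == i + m)%N%:R.
  move=> im; have lt_n : (i + m < n)%N.
    by case/andP: im => _ im; rewrite (leq_trans _ le_n) // ltnS leq_add2r.
  have -> : alg_mul lam x (col i B) = col (Ordinal lt_n) B.
    rewrite cy // cB /=; last by case/andP: im => _ im; rewrite ltnS leq_add2r.
    case: i im {lt_n} => [[|i] hi] //= im.
    by rewrite nth_cat ltnNge leq_addl /= addnK (nth_map 0).
  by rewrite row_inv_col.
have yxi (i : 'I_n) : (0 < i <= m)%N -> alg_mul lam (col i B) x = - alg_mul lam x (col i B).
  move=> im; rewrite cy // yx // mem_nth //.
  by case: (val i) im.
have s0 (i j k : 'I_n) : val i = 0%N -> val j = 0%N -> sconst lam B (i, j, k) = 0.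
  by move=> i0 j0; rewrite sconstE // !cx // xx mulmx0 mxE.
apply: (@degenerates_weights _ _ lam _ B (star_weight m)) => // i j k.
  rewrite /star_weight.
  case: (val i =P 0)%N => i0; case: (val j =P 0)%N => j0; first by rewrite s0.
  - by do ?[case: ifP => //].
  - by do ?[case: ifP => //].
  - by do ?[case: ifP => //].
rewrite ffunE /= /star_weight.
case: (posnP i) => [i0|i_gt] /=; case: (posnP j) => [j0|j_gt] /=.
- by do ?[case: ifP => //].
- case: (leqP j m) => [jm|mj] /=; last by do ?[case: ifP => //].
  rewrite sconstE // (cx i) // row_xy ?j_gt //.
  case: (val k =P j + m)%N => [->|_]; last by rewrite if_same.
  by rewrite addn_eq0 -!leqn0 leqNgt j_gt /= leqNgt -addn1 addnC leq_add2r j_gt leq_add2r jm.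
- case: (leqP i m) => [im|mi] /=; last by do ?[case: ifP => //].
  rewrite sconstE // (cx j) // yxi ?i_gt // mulmxN mxE row_xy ?i_gt //.
  case: (val k =P i + m)%N => [->|_]; last by rewrite oppr0 if_same.
  by rewrite addn_eq0 -!leqn0 leqNgt i_gt /= leqNgt -addn1 addnC leq_add2r i_gt leq_add2r im.
- by do ?[case: ifP => //].
Qed.

Lemma n3E : n3 K n = star_alg 1.
Proof.
apply/ffunP => -[[[i hi] [j hj]] [k hk]]; rewrite !ffunE /= /form2.
by case: i hi => [|[|i]] hi; case: j hj => [|[|j]] hj; rewrite //= ?if_same.
Qed.

Lemma n52E : n52 = star_alg 2 :> alg K n.
Proof.
apply/ffunP => -[[[i hi] [j hj]] [k hk]]; rewrite !ffunE /=.
case: i hi => [|[|[|i]]] hi; case: j hj => [|[|[|j]]] hj; rewrite /= ?mxE //= ?mxE ?eqSS //=;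
 by case: eqP => //; rewrite ?oppr0.
Qed.

Lemma degenerates_n51 lam x y p q v :
    let m := alg_mul lam in
    (forall z, z \in [:: x; y; p; q] -> m z z = 0) ->
    (forall z t, z \in [:: x; y; p; q] -> t \in [:: x; y; p; q] -> m t z = - m z t) ->
    m x y = v -> m p q = v -> m x p = 0 -> m x q = 0 -> m y p = 0 -> m y q = 0 ->
    free [:: x; y; p; q; v] ->
  degenerates lam n51.
Proof.
move=> m sq an xy pq xp xq yp yq fX; have [F dF] := free_dual fX.
have := @degenerates_form _ _ lam _ _ _ dF erefl.
rewrite n51E; congr degenerates; apply: eq_form_alg.
have Fv : (F`_4 *m v) 0 0 = 1 by case: dF => _ /(_ 4 4)%N ->.
have FN : (F`_4 *m - v) 0 0 = -1 by rewrite mulmxN mxE Fv.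
have F0 : (F`_4 *m (0 : 'cV[K]_n)) 0 0 = 0 by rewrite mulmx0 mxE.
have sx := sq x; have sy := sq y; have sp := sq p; have sq' := sq q.
have yx := an x y; have px := an x p; have qx := an x q.
have py := an y p; have qy := an y q; have qp := an p q.
rewrite !inE !eqxx ?orbT /= in sx sy sp sq' yx px qx py qy qp.
rewrite /m in sx sy sp sq' yx px qx py qy qp xy pq xp xq yp yq *.
by move=> [|[|[|[|i]]]] [|[|[|[|j]]]] //= _ _; rewrite /symp4 /form2 /=
  ?xy ?pq ?xp ?xq ?yp ?yq ?sx ?sy ?sp ?sq' ?yx ?px ?qx ?py ?qy ?qp //
  ?xy ?pq ?xp ?xq ?yp ?yq ?oppr0 ?Fv ?FN ?F0.
Qed.

End Criteria.

(** * The listed algebras: degenerations and non-isomorphisms *)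

Section Entries.
Variables (K : fieldType) (n : nat).

Lemma colDE (u v : 'cV[K]_n) i : (u + v) i 0 = u i 0 + v i 0. Proof. exact: mxE. Qed.
Lemma colNE (u : 'cV[K]_n) i : (- u) i 0 = - u i 0. Proof. exact: mxE. Qed.
Lemma colZE a (u : 'cV[K]_n) i : (a *: u) i 0 = a * u i 0. Proof. exact: mxE. Qed.
Lemma col0E i : (0 : 'cV[K]_n) i 0 = 0. Proof. exact: mxE. Qed.
Definition col_linE := (colDE, colNE, colZE, col0E).

Lemma iso_mul lam mu : @isomorphic K n lam mu ->
  exists2 g, g \in unitmx &
    forall x y, alg_mul mu (g *m x) (g *m y) = g *m alg_mul lam x y.
Proof. by case=> g ug ->; exists g => // x y; rewrite alg_mul_act !mulKmx. Qed.
End Entries.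

Section Table.
Variables (K : numFieldType) (n : nat) (hn : (5 <= n)%N).
Implicit Types (lam mu nu : alg K n) (x y z v : 'cV[K]_n).

Definition o0 : 'I_n := Ordinal (leq_trans (isT : 0 < 5)%N hn).
Definition o1 : 'I_n := Ordinal (leq_trans (isT : 1 < 5)%N hn).
Definition o2 : 'I_n := Ordinal (leq_trans (isT : 2 < 5)%N hn).
Definition o3 : 'I_n := Ordinal (leq_trans (isT : 3 < 5)%N hn).
Definition o4 : 'I_n := Ordinal (leq_trans (isT : 4 < 5)%N hn).
Local Notation E i := (delta_mx i 0 : 'cV[K]_n).

Lemma e_delta (i : 'I_n) : e_ K n i.+1 = E i.
Proof. by apply/colP => k; rewrite !mxE eqSS andbT. Qed.

Lemma e3 : e_ K n 3 = E o2. Proof. exact: (e_delta o2). Qed.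
Lemma e4 : e_ K n 4 = E o3. Proof. exact: (e_delta o3). Qed.
Lemma e5 : e_ K n 5 = E o4. Proof. exact: (e_delta o4). Qed.
Definition eE := (e3, e4, e5).

Lemma algM_table f (i j : 'I_n) :
  alg_mul (table f) (E i) (E j) = f i.+1 j.+1 :> 'cV[K]_n.
Proof. by apply/colP => k; rewrite algM_delta ffunE. Qed.

Lemma algM_form2 a b c d x y : alg_mul (form_alg n 2 (form2 a b c d)) x y =
  (a * x o0 0 * y o0 0 + b * x o0 0 * y o1 0 + c * x o1 0 * y o0 0
   + d * x o1 0 * y o1 0) *: E o2.
Proof.
apply/colP => k; rewrite !mxE andbT.
pose G (i j : 'I_n) := x i 0 * y j 0 * form_alg n 2 (form2 a b c d) (i, j, k).
have G0 (i j : 'I_n) : (1 < i)%N || (1 < j)%N -> G i j = 0.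
  by case: i j => [[|[|i]] hi] [[|[|j]] hj] //= _; rewrite /G ffunE /= mulr0.
have sumG (f : 'I_n -> K) : (forall i : 'I_n, (1 < i)%N -> f i = 0) ->
    \sum_i f i = f o0 + f o1.
  move=> f0; rewrite (bigD1 o0) //= (bigD1 o1) //= big1 ?addr0 // => i /andP[i0 i1].
  by apply: f0; case: i i0 i1 => [[|[|i]] hi].
rewrite (eq_bigr (fun i => G i o0 + G i o1)) => [|i _]; last first.
  by apply: sumG => j j1; apply: G0; rewrite j1 orbT.
rewrite sumG => [|i i1]; last by rewrite !G0 ?i1 ?addr0.
rewrite /G !ffunE /= /form2 -(inj_eq val_inj) /=.
by case: eqP => _ /=; rewrite ?mulr1 ?mulr0; ring.
Qed.

Lemma algM_n3 x y :
  alg_mul (n3 K n) x y = (x o0 0 * y o1 0 - x o1 0 * y o0 0) *: E o2.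
Proof. by rewrite algM_form2; congr (_ *: _); ring. Qed.

Lemma algM_lam2 x y : alg_mul (lam2 K n) x y = (x o0 0 * y o0 0) *: E o1.
Proof.
apply/colP => k; rewrite !mxE andbT (bigD1 o0) //= (bigD1 o0) //=.
rewrite big1 => [|j j0]; last first.
  by rewrite ffunE /=; case: j j0 => [[|j] hj] //=; rewrite mulr0.
rewrite big1 => [|i i0]; last first.
  by apply: big1 => j _; rewrite ffunE /=; case: i i0 => [[|i] hi] //=; rewrite mulr0.
by rewrite ffunE /= -(inj_eq val_inj) /= !addr0; case: eqP.
Qed.

Lemma delta_neq0 (i : 'I_n) : E i <> 0.
Proof. by move/colP/(_ i)/eqP; rewrite !mxE !eqxx oner_eq0. Qed.

Lemma unitmx_mul_eq0 (g : 'M[K]_n) v : g \in unitmx -> g *m v = 0 -> v = 0.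
Proof. by move=> ug gv; rewrite -(mulKmx ug v) gv mulmx0. Qed.

(** The algebra lam2 is commutative. *)
Lemma L4_niso_lam2 al : ~ isomorphic (L4 al) (lam2 K n).
Proof.
case/iso_mul => g ug h; apply: (delta_neq0 (i := o2)); apply: (unitmx_mul_eq0 ug).
have := h (E o0) (E o1); rewrite algM_table /= ?eE => <-.
have := h (E o1) (E o0); rewrite algM_table /= mulmx0 => <-.
by rewrite !algM_lam2 mulrC.
Qed.

(** In lam2 a vector of square zero annihilates everything; in L5 the second basis vector does not. *)
Lemma L5_niso_lam2 : ~ isomorphic L5 (lam2 K n).
Proof.
case/iso_mul => g ug h; apply: (delta_neq0 (i := o2)); apply: (unitmx_mul_eq0 ug).
have := h (E o1) (E o1); rewrite algM_table /= mulmx0 algM_lam2 => /eqP.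
rewrite scaler_eq0 mulf_eq0 orbb => /orP[/eqP e|/eqP/delta_neq0//].
have := h (E o1) (E o0); rewrite algM_table /= ?eE => <-.
by rewrite algM_lam2 e mul0r scale0r.
Qed.

(** All squares vanish in n3. *)
Lemma L4_niso_n3 al : ~ isomorphic (L4 al) (n3 K n).
Proof.
case/iso_mul => g ug h; apply: (delta_neq0 (i := o2)); apply: (unitmx_mul_eq0 ug).
have := h (E o0) (E o0); rewrite algM_table /= ?eE => <-.
by rewrite algM_n3 mulrC subrr scale0r.
Qed.

(** In n3, a vector annihilating two vectors with nonzero product annihilates everything. *)
Lemma n51_niso_n3 : ~ isomorphic n51 (n3 K n).
Proof.
case/iso_mul => g ug h; apply: (delta_neq0 (i := o4)); apply: (unitmx_mul_eq0 ug).
have h01 := h (E o0) (E o1); rewrite algM_table /= ?eE in h01.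
have h20 := h (E o2) (E o0); rewrite algM_table /= mulmx0 in h20.
have h21 := h (E o2) (E o1); rewrite algM_table /= mulmx0 in h21.
have h23 := h (E o2) (E o3); rewrite algM_table /= ?eE in h23.
move: h01 h20 h21 h23; rewrite !algM_n3.
move: (g *m E o0) (g *m E o1) (g *m E o2) (g *m E o3) => x y p q.
have Z (a : K) : a *: E o2 = 0 -> a = 0.
  by move/eqP; rewrite scaler_eq0 => /orP[/eqP//|/eqP/delta_neq0].
move=> xy /Z px /Z py pq.
have [e|ne] := eqVneq (x o0 0 * y o1 0 - x o1 0 * y o0 0) 0.
  by rewrite -xy e scale0r.
have p0 : p o0 0 = 0.
  apply: (mulIf ne); rewrite mul0r.
  transitivity (x o0 0 * (p o0 0 * y o1 0 - p o1 0 * y o0 0)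
    - y o0 0 * (p o0 0 * x o1 0 - p o1 0 * x o0 0)); first by ring.
  by rewrite px py !mulr0 subrr.
have p1 : p o1 0 = 0.
  apply: (mulIf ne); rewrite mul0r.
  transitivity (x o1 0 * (p o0 0 * y o1 0 - p o1 0 * y o0 0)
    - y o1 0 * (p o0 0 * x o1 0 - p o1 0 * x o0 0)); first by ring.
  by rewrite px py !mulr0 subrr.
by rewrite -pq p0 p1 !mul0r subrr scale0r.
Qed.

(** In n3 all products lie on one line. *)
Lemma n52_niso_n3 : ~ isomorphic n52 (n3 K n).
Proof.
case/iso_mul => g ug h; apply: (delta_neq0 (i := o3)); apply: (unitmx_mul_eq0 ug).
have [a ea] : exists a, a *: E o2 = g *m E o3.
  by eexists; have := h (E o0) (E o1); rewrite algM_table /= ?eE algM_n3; exact.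
have [b eb] : exists b, b *: E o2 = g *m E o4.
  by eexists; have := h (E o0) (E o2); rewrite algM_table /= ?eE algM_n3; exact.
have : g *m (b *: E o3 - a *: E o4) = 0.
  by rewrite mulmxBr -!scalemxAr -ea -eb !scalerA mulrC subrr.
move/(unitmx_mul_eq0 ug)/colP/(_ o4); rewrite !mxE -!(inj_eq val_inj) /=.
rewrite mulr0 mulr1 sub0r => /eqP; rewrite oppr_eq0 => /eqP a0.
by rewrite -ea a0 scale0r.
Qed.

Lemma lam2_neq0 : lam2 K n <> abelian_alg K n.
Proof.
move/(congr1 (fun lam => alg_mul lam (E o0) (E o0))).
by rewrite algM_abelian algM_lam2 !mxE !eqxx mulr1 scale1r; apply: delta_neq0.
Qed.

Lemma n3_neq0 : n3 K n <> abelian_alg K n.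
Proof.
move/(congr1 (fun lam => alg_mul lam (E o0) (E o1))).
rewrite algM_abelian algM_n3 !mxE -!(inj_eq val_inj) /= mulr1 mulr0 subr0 scale1r.
exact: delta_neq0.
Qed.

Lemma L4_degenerates_lam2 al : degenerates (L4 al) (lam2 K n).
Proof.
apply: (@degenerates_lam2 _ _ _ (E o0)); rewrite algM_table /= ?eE.
exact: (@free_delta _ _ [:: o0; o2]).
Qed.

Lemma L5_degenerates_lam2 : degenerates L5 (lam2 K n).
Proof.
apply: (@degenerates_lam2 _ _ _ (E o0)); rewrite algM_table /= ?eE.
exact: (@free_delta _ _ [:: o0; o2]).
Qed.

Lemma degenerates_n3 lam x y :
    alg_mul lam x x = 0 -> alg_mul lam y x = - alg_mul lam x y ->
    free [:: x; y; alg_mul lam x y] ->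
  degenerates lam (n3 K n).
Proof.
move=> xx yx f; rewrite n3E; apply: (@degenerates_star _ _ lam x [:: y]) => // z.
by rewrite inE => /eqP ->.
Qed.

Lemma n51_degenerates_n3 : degenerates n51 (n3 K n).
Proof.
apply: (@degenerates_n3 _ (E o0) (E o1)); rewrite !algM_table //= ?eE.
exact: (@free_delta _ _ [:: o0; o1; o4]).
Qed.

Lemma n52_degenerates_n3 : degenerates n52 (n3 K n).
Proof.
apply: (@degenerates_n3 _ (E o0) (E o1)); rewrite !algM_table //= ?eE.
exact: (@free_delta _ _ [:: o0; o1; o3]).
Qed.

(** The value 1/4 is the one for which the symmetric part of the form is degenerate. Its radical is
    spanned by e_1 - 2 e_2, which therefore has square zero and anticommutes with e_2. *)
Lemma L4_degenerates_n3 : degenerates (L4 (4%:R^-1)) (n3 K n).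
Proof.
have n4 : 4%:R != 0 :> K by rewrite pnatr_eq0.
have n2 : 2%:R != 0 :> K by rewrite pnatr_eq0.
have xE : (E o0 - 2%:R *: E o1) o0 0 = 1.
  by rewrite !mxE -!(inj_eq val_inj) /= mulr0 subr0.
have xE1 : (E o0 - 2%:R *: E o1) o1 0 = - 2%:R.
  by rewrite !mxE -!(inj_eq val_inj) /= mulr1 sub0r.
have yE : E o1 o0 0 = 0 by rewrite !mxE -!(inj_eq val_inj).
have yE1 : E o1 o1 0 = 1 by rewrite !mxE -!(inj_eq val_inj).
have xy : alg_mul (L4 4%:R^-1) (E o0 - 2%:R *: E o1) (E o1) = 2%:R^-1 *: E o2.
  by rewrite L4E algM_form2 xE xE1 yE yE1; congr (_ *: _); field.
apply: (@degenerates_n3 _ (E o0 - 2%:R *: E o1) (E o1)).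
- rewrite L4E algM_form2 xE xE1.
  by rewrite [X in X *: _](_ : _ = 0) ?scale0r //; field.
- by rewrite xy L4E algM_form2 xE xE1 yE yE1 -scaleNr; congr (_ *: _); field.
rewrite xy; apply/free3P => a b c /colP e; have := e o0; have := e o1; have := e o2.
rewrite !mxE -!(inj_eq val_inj) /= !(mulr0, mulr1, addr0, subr0, add0r, sub0r).
move=> c0 b0 a0; rewrite a0 mul0r add0r in b0; split=> //.
by move/eqP: c0; rewrite a0 mul0r add0r mulf_eq0 invr_eq0 (negPf n2) orbF => /eqP.
Qed.

End Table.

Ltac vring := apply/colP => ?; rewrite ?col_linE; ring.

Lemma scaler_cancel (K : fieldType) (V : lmodType K) (a : K) (v : V) :
  v <> 0 -> a *: v = 0 -> a = 0.
Proof. by move=> v0 /eqP; rewrite scaler_eq0 => /orP[/eqP//|/eqP]. Qed.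

(** * Recognizing an algebra with a one-dimensional square *)

Section IsoForm.
Variables (K : numFieldType) (n : nat).
Implicit Types (lam mu nu : alg K n) (x y z v : 'cV[K]_n) (B : 'M[K]_n).

(** The vectors X can be completed to a basis by vectors killed by the forms F, and all products
    with these vanish. *)
Lemma iso_form lam d F X (b : nat -> nat -> K) : dual_families F X -> size X = d.+1 ->
    (forall p q, alg_mul lam p q =
       (\sum_(i < d) \sum_(j < d)
          b i j * (F`_i *m p) 0 0 * (F`_j *m q) 0 0) *: X`_d) ->
  isomorphic lam (form_alg n d b).
Proof.
move=> dFX sX mulE; have lt_dn := free_size (dual_free dFX).
have [B uB [cB rB]] := dual_completion dFX.
suff -> : form_alg n d b = sconst lam B by apply: iso_sconst.
rewrite sX in lt_dn cB rB.
have FE (a : 'I_d) (i : 'I_n) : (F`_a *m col i B) 0 0 = (val a == i)%:R.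
  have lt_an : (a < n)%N := leq_trans (ltn_ord a) (ltnW lt_dn).
  by rewrite -(rB (Ordinal lt_an)) ?row_inv_col //= ltnS ltnW.
apply/ffunP => -[[i j] k]; rewrite sconstE // mulE -scalemxAr colZE ffunE /=.
have := cB (Ordinal lt_dn); rewrite /= ltnS leqnn => /(_ isT) <-.
rewrite row_inv_col // -(inj_eq val_inj) /=.
under eq_bigr do under eq_bigr do rewrite !FE.
case: (ltnP i d) => [lid|dli] /=; last first.
  rewrite big1 ?mul0r // => a _; rewrite big1 // => c _.
  by rewrite (ltn_eqF (leq_trans (ltn_ord a) dli)) mulr0 mul0r.
case: (ltnP j d) => [ljd|dlj] /=; last first.
  rewrite big1 ?mul0r // => a _; rewrite big1 // => c _.
  by rewrite (ltn_eqF (leq_trans (ltn_ord c) dlj)) mulr0.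
rewrite (bigD1 (Ordinal lid)) //= (bigD1 (Ordinal ljd)) //= !eqxx !mulr1.
rewrite !big1 => [|a ai|c cj]; last first.
- by rewrite -(inj_eq val_inj) /= in cj; rewrite (negPf cj) mulr0.
- rewrite big1 // => c _.
  by rewrite -(inj_eq val_inj) /= in ai; rewrite (negPf ai) mulr0 mul0r.
by rewrite !addr0; case: eqP; rewrite ?mulr1 ?mulr0.
Qed.

Lemma algM_mxl lam x : exists M : 'M[K]_n, forall z, alg_mul lam x z = M *m z.
Proof.
exists (\matrix_(k, j) \sum_i x i 0 * lam (i, j, k)) => z; apply/colP => k.
rewrite !mxE exchange_big; apply: eq_bigr => j _; rewrite !mxE mulr_suml.
by apply: eq_bigr => i _; ring.
Qed.

Lemma algM_mxr lam y : exists M : 'M[K]_n, forall z, alg_mul lam z y = M *m z.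
Proof.
exists (\matrix_(k, i) \sum_j y j 0 * lam (i, j, k)) => z; apply/colP => k.
rewrite !mxE; apply: eq_bigr => i _; rewrite !mxE mulr_suml.
by apply: eq_bigr => j _; ring.
Qed.

End IsoForm.

(** * Nilpotent algebras *)

Section Nilpotent.
Variables (K : numFieldType) (n : nat).
Implicit Types (lam mu nu : alg K n) (x y z u v : 'cV[K]_n) (g : 'M[K]_n).

Fixpoint map_bracket (f : 'cV[K]_n -> 'cV[K]_n) (t : bracketing K n) : bracketing K n :=
  match t with
  | Factor x => Factor (f x)
  | Bracket t1 t2 => Bracket (map_bracket f t1) (map_bracket f t2)
  end.

Lemma nfactors_map f t : nfactors (map_bracket f t) = nfactors t.
Proof. by elim: t => //= t1 -> t2 ->. Qed.

Lemma bracket_value_act g lam t : g \in unitmx ->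
  bracket_value (gl_act g lam) t = g *m bracket_value lam (map_bracket (mulmx (invmx g)) t).
Proof.
move=> ug; elim: t => [x|t1 IH1 t2 IH2] /=; first by rewrite mulKVmx.
by rewrite alg_mul_act IH1 IH2 !mulKmx.
Qed.

(** For a fixed bracketing, the vanishing of its value is a closed condition, and the whole orbit of
    lam satisfies it. *)
Lemma degenerates_nilpotent lam mu :
  degenerates lam mu -> nilpotent_alg lam -> nilpotent_alg mu.
Proof.
move=> /degeneratesP d [m m0 lam0]; exists m => // t tm; apply/colP => k.
rewrite [RHS]mxE; apply: (d (fun nu => bracket_value nu t k 0)).
  exact: regular_bracket.
move=> _ [g ug ->]; rewrite bracket_value_act // lam0 ?mulmx0 ?mxE //.
by rewrite nfactors_map.
Qed.

(** Linear combinations of products of exactly k factors. They allow operators which are sums of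
    multiplications, such as commutators, to be treated like single multiplications. *)
Inductive prodspan lam : nat -> 'cV[K]_n -> Prop :=
| ProdBracket t : prodspan lam (nfactors t) (bracket_value lam t)
| ProdLin k a u v :
    prodspan lam k u -> prodspan lam k v -> prodspan lam k (a *: u + v).

Lemma prodspan_mull lam k z v :
  prodspan lam k v -> prodspan lam k.+1 (alg_mul lam z v).
Proof.
elim=> {k v} [t|k a u v _ IHu _ IHv]; first exact: (ProdBracket lam (Bracket (Factor z) t)).
by rewrite alg_mul_linear_r; apply: ProdLin.
Qed.

Lemma prodspan_mulr lam k z v :
  prodspan lam k v -> prodspan lam k.+1 (alg_mul lam v z).
Proof.
elim=> {k v} [t|k a u v _ IHu _ IHv]; last by rewrite alg_mul_linear_l; apply: ProdLin.
by rewrite -addn1; exact: (ProdBracket lam (Bracket t (Factor z))).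
Qed.

Lemma nilpotent_prodspan lam : nilpotent_alg lam ->
  exists2 m, (0 < m)%N & forall v, prodspan lam m v -> v = 0.
Proof.
case=> m m0 lam0; exists m => // v pv; move: {1 2}m pv (erefl m) => k.
elim=> [t /lam0//|k' a u {}v _ IHu _ IHv e].
by rewrite IHu // IHv // scaler0 addr0.
Qed.

Lemma prodspanZ lam k a u : prodspan lam k u -> prodspan lam k (a *: u).
Proof.
move=> pu; have p0 : prodspan lam k 0.
  by have := ProdLin (-1) pu pu; rewrite scaleN1r addNr.
by have := ProdLin a pu p0; rewrite addr0.
Qed.

Lemma prodspan_commutator lam k x u : prodspan lam k u ->
  prodspan lam k.+1 (alg_mul lam x u - alg_mul lam u x).
Proof.
move=> pu; have := ProdLin (-1) (prodspan_mulr x pu) (prodspan_mull x pu).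
by rewrite scaleN1r addrC.
Qed.

(** An eigenvector for a nonzero eigenvalue of T is a combination of products of arbitrarily many
    factors. The conclusion is phrased so as to cover the eigenvalue 0 and the zero vector at once. *)
Lemma nilpotent_eigen lam (T : 'cV[K]_n -> 'cV[K]_n) a v :
    nilpotent_alg lam ->
    (forall k u, prodspan lam k u -> prodspan lam k.+1 (T u)) ->
    T v = a *: v -> a *: v = 0.
Proof.
move=> /nilpotent_prodspan[m m0 lam0] hT Tv.
have [->|a0] := eqVneq a 0; first by rewrite scale0r.
suff pv k : prodspan lam k.+1 v by rewrite [v]lam0 ?scaler0 // -(prednK m0).
elim: k => [|k /hT]; first exact: (ProdBracket lam (Factor v)).
by rewrite Tv => /(prodspanZ a^-1); rewrite scalerA mulVf // scale1r.
Qed.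

Lemma nilpotent_eigenl lam z a v :
  nilpotent_alg lam -> alg_mul lam z v = a *: v -> a *: v = 0.
Proof.
by move=> nl; apply: (@nilpotent_eigen lam (alg_mul lam z)) => // k u; apply: prodspan_mull.
Qed.

Lemma nilpotent_eigenr lam z a v :
  nilpotent_alg lam -> alg_mul lam v z = a *: v -> a *: v = 0.
Proof.
by move=> nl; apply: (@nilpotent_eigen lam (alg_mul lam ^~ z)) => // k u; apply: prodspan_mulr.
Qed.

Lemma nilpotent_iter lam : nilpotent_alg lam ->
  exists m, forall x v, iter m (alg_mul lam x) v = 0.
Proof.
move=> /nilpotent_prodspan[m m0 lam0]; exists m.-1 => x v; apply: lam0.
rewrite -[in X in prodspan _ X](prednK m0).
elim: m.-1 => [|k IH] /=; first exact: (ProdBracket lam (Factor v)).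
exact: prodspan_mull.
Qed.

(** Modulo W the vector z is fixed by c times the nilpotent operator of multiplication by x. *)
Lemma stable_closed lam x z c (W : {vspace 'cV[K]_n}) :
    nilpotent_alg lam ->
    (forall w, w \in W -> alg_mul lam x w \in W) -> z - c *: (alg_mul lam x z) \in W ->
  z \in W.
Proof.
move=> nl Wx zW; have [m m0] := nilpotent_iter nl.
have h k : z - c ^+ k *: iter k (alg_mul lam x) z \in W.
  elim: k => [|k IH] /=; first by rewrite scale1r subrr mem0v.
  have := memvD zW (memvZ c (Wx _ IH)).
  congr (_ \in W); rewrite !algME exprS -!scalerA.
  by vring.
by have := h m; rewrite m0 scaler0 subr0.
Qed.

(** A relation a x + b y + c w = 0, with w = [x, y] and c nonzero, makes w an eigenvector of
    the commutator with x (eigenvalue - b / c) and of the commutator with y (eigenvalue a / c). *)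
Lemma commutator_free lam x y : nilpotent_alg lam ->
  alg_mul lam x y - alg_mul lam y x <> 0 ->
  free [:: x; y; alg_mul lam x y - alg_mul lam y x].
Proof.
pose ad z u := alg_mul lam z u - alg_mul lam u z; rewrite -[_ - _]/(ad x y).
move=> nl w0; apply/free3P => a b c e.
have adeig z k u : ad z u = k *: u -> k *: u = 0.
  by apply: (@nilpotent_eigen lam (ad z)) => // ? ? /(prodspan_commutator z).
have adE z : a *: ad z x + b *: ad z y + c *: ad z (ad x y) = 0.
  transitivity (ad z (a *: x + b *: y + c *: ad x y)).
    by rewrite /ad !algME; vring.
  by rewrite e /ad !algME subrr.
have ex : c *: ad x (ad x y) = (- b) *: ad x y.
  apply/eqP; rewrite -subr_eq0 -[X in _ == X](adE x) [ad x x]subrr; apply/eqP.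
  by vring.
have ey : c *: ad y (ad x y) = a *: ad x y.
  apply/eqP; rewrite -subr_eq0 -[X in _ == X](adE y) [ad y y]subrr.
  by rewrite (_ : ad y x = - ad x y) ?opprB //; apply/eqP; vring.
have b0 : b = 0.
  apply/eqP; rewrite -oppr_eq0; apply/eqP; apply: (scaler_cancel w0).
  have [c0|c0] := eqVneq c 0; first by rewrite -ex c0 scale0r.
  have /adeig e0 : ad x (ad x y) = (- b / c) *: ad x y.
    by apply: (scalerI c0); rewrite ex scalerA mulrC mulfVK.
  by rewrite -(mulfVK c0 (- b)) mulrC -scalerA e0 scaler0.
have a0 : a = 0.
  apply: (scaler_cancel w0).
  have [c0|c0] := eqVneq c 0; first by rewrite -ey c0 scale0r.
  have /adeig e0 : ad y (ad x y) = (a / c) *: ad x y.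
    by apply: (scalerI c0); rewrite ey scalerA mulrC mulfVK.
  by rewrite -(mulfVK c0 a) mulrC -scalerA e0 scaler0.
by split=> //; apply: (scaler_cancel w0); rewrite -[RHS]e a0 b0 !scale0r !add0r.
Qed.

(** Two factors that are multiplied with each other can be declared a single factor. *)
Lemma bracket_merge lam t : (1 < nfactors t)%N ->
  exists2 t', nfactors t' = (nfactors t).-1 & bracket_value lam t' = bracket_value lam t.
Proof.
have nf_gt0 (s : bracketing K n) : (0 < nfactors s)%N by elim: s => //= s1 h s2 _; rewrite addn_gt0 h.
elim: t => [//|t1 IH1 t2 IH2] _ /=.
have [/IH1[t' n' v']|n1] := ltnP 1 (nfactors t1).
  by exists (Bracket t' t2); rewrite /= ?v' // n' -!subn1 addnBAC.
have [/IH2[t' n' v']|n2] := ltnP 1 (nfactors t2).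
  by exists (Bracket t1 t'); rewrite /= ?v' // n' -!subn1 addnBA.
exists (Factor (alg_mul lam (bracket_value lam t1) (bracket_value lam t2))) => //=.
have := nf_gt0 t1; have := nf_gt0 t2.
by case: (nfactors t1) (nfactors t2) n1 n2 => [|[|?]] [|[|?]].
Qed.

Lemma prodspan_weaken lam k v : (0 < k)%N -> prodspan lam k.+1 v -> prodspan lam k v.
Proof.
move=> k0; move e: k.+1 => k' pv.
elim: pv e => [t e|k1 a u w _ IHu _ IHw e].
  have [|t' n' <-] := @bracket_merge lam t; first by rewrite -e ltnS.
  by rewrite -[k]/(k.+1.-1) e -n'; apply: ProdBracket.
by apply: ProdLin; [apply: IHu | apply: IHw].
Qed.

(** The vectors x, x x and x (x x) form a chain under the multiplication L by x. If a relation
    involves x, then x = T x for a polynomial T in L without constant term; if it only involves the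
    last two, then x x is an eigenvector of L. *)
Lemma square_chain_free lam x (u := alg_mul lam x x) : nilpotent_alg lam ->
  alg_mul lam x u <> 0 -> free [:: x; u; alg_mul lam x u].
Proof.
move=> nl w0; set w := alg_mul lam x u in w0 *.
apply/free3P => a b c e.
have a0 : a = 0.
  have [//|a0] := eqVneq a 0; case: w0.
  pose T z := (- (b / a)) *: alg_mul lam x z + (- (c / a)) *: alg_mul lam x (alg_mul lam x z).
  suff x0 : 1 *: x = 0 by rewrite /w /u -(scale1r x) x0 !algME.
  apply: (@nilpotent_eigen lam T) => // [k z pz|].
    apply: ProdLin; first exact: prodspan_mull.
    by apply: prodspanZ; apply: prodspan_weaken => //; do 2!apply: prodspan_mull.
  rewrite /T -/u -/w; apply: (scalerI a0); apply/eqP; rewrite eq_sym -subr_eq0 -[X in _ == X]e.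
  by apply/eqP/colP => i; rewrite !col_linE; field.
rewrite a0 scale0r add0r in e.
have b0 : b = 0.
  have u0 : u <> 0 by move=> u0; apply: w0; rewrite /w u0 algM0r.
  apply: (scaler_cancel u0).
  have [c0|c0] := eqVneq c 0; first by rewrite -[RHS]e c0 scale0r addr0.
  have e0 : alg_mul lam x u = (- b / c) *: u.
    apply: (scalerI c0); apply/eqP; rewrite -subr_eq0 -[X in _ == X]e -/w.
    by apply/eqP/colP => i; rewrite !col_linE; field.
  by case: w0; rewrite /w e0; apply: nilpotent_eigenl nl e0.
by split=> //; apply: (scaler_cancel w0); rewrite -[RHS]e b0 scale0r add0r.
Qed.

Lemma exists_notin_span (X : seq 'cV[K]_n) : (size X < n)%N ->
  exists z, z \notin <<X>>%VS.
Proof.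
move=> lt; apply: contrapT => h; have : (fullv <= <<X>>)%VS.
  by apply/subvP => z _; apply: contrapT => /negP zW; apply: h; exists z.
move/dimvS; rewrite dimvf dim_matrix (_ : (n * 1)%R = n); last exact: muln1.
by move=> /leq_trans/(_ (dim_span _)); rewrite leqNgt lt.
Qed.

End Nilpotent.

(** * Anticommutative nilpotent algebras *)

Section Span4.
Variables (K : fieldType) (V : vectType K).
Implicit Types (x y z t v : V).

Lemma span4P x y z t v :
  v \in <<[:: x; y; z; t]>>%VS <->
  exists a b c d, v = a *: x + b *: y + c *: z + d *: t.
Proof.
rewrite !span_cons span_nil addv0; split.
  case/memv_addP => _ /vlineP[a ->] [_ /memv_addP[_ /vlineP[b ->]
    [_ /memv_addP[_ /vlineP[c ->] [_ /vlineP[d ->] ->]] ->]] ->].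
  by exists a, b, c, d; rewrite !addrA.
case=> a [b [c [d ->]]]; rewrite -!addrA.
by do !(apply: memv_add); apply: memvZ; apply: memv_line.
Qed.

End Span4.

Section Anticommutative.
Variables (K : numFieldType) (n : nat) (hn : (5 <= n)%N) (lam : alg K n).
Hypothesis lam_nil : nilpotent_alg lam.
Hypothesis anti : forall x y, alg_mul lam y x = - alg_mul lam x y.
Implicit Types (x y z u v p q : 'cV[K]_n).
Local Notation "x ** y" := (alg_mul lam x y) (at level 40, left associativity).

Lemma anti_sq x : x ** x = 0.
Proof.
apply: (@scalerI _ _ 2%:R); first by rewrite pnatr_eq0.
by rewrite scaler0 scaler_nat mulr2n {1}anti addNr.
Qed.

Lemma anti_free3 x y : x ** y <> 0 -> free [:: x; y; x ** y].
Proof.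
move=> xy0; have n2 : 2%:R != 0 :> K by rewrite pnatr_eq0.
have cE : x ** y - y ** x = 2%:R *: (x ** y) by rewrite anti; vring.
have : x ** y - y ** x <> 0.
  by rewrite cE => /eqP; rewrite scaler_eq0 (negPf n2) => /eqP.
move=> /(commutator_free lam_nil)/free3P f; apply/free3P => a b c e.
have [|-> -> /eqP] := f a b (c / 2%:R).
  by rewrite cE scalerA mulfVK.
by rewrite mulf_eq0 invr_eq0 (negPf n2) orbF => /eqP ->.
Qed.

(** Let L be multiplication by x, which is nilpotent, kills x and has rank at least two. If L ^ 2 = 0,
    the given y and z do. Otherwise choose y with L ^ 3 y = 0 and L ^ 2 y nonzero, so that
    W = span (x, y, L y, L ^ 2 y) is four-dimensional and L-stable; as the dimension is at least
    five, there is z outside W. If L z is outside W, take y and z. If L z is in W, then after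
    changing z modulo W one has L z = al x + be y. For nonzero be there is a longer chain, and
    z, L y do; otherwise L z = 0, and the extra vector z separates L y from its role
    as an image: y and L y + z do. *)
Lemma anti_pair_image x y z : free [:: x ** y; x ** z] ->
  exists y' z', free [:: x; y'; z'; x ** y'; x ** z'].
Proof.
move=> fyz; have /free2P {}fyz := fyz.
have x0 : x <> 0.
  move=> x0; case: (fyz 1 0); first by rewrite x0 !algM0l !scaler0 addr0.
  by move/eqP; rewrite oner_eq0.
have xeig a w : x ** w = a *: x -> a = 0.
  by move/(nilpotent_eigenr lam_nil); apply: scaler_cancel.
have [[u u2]|noL2] := pselect (exists u, x ** (x ** u) <> 0); last first.
  have L2 u : x ** (x ** u) = 0 by apply: contrapT => h; apply: noL2; exists u.
  exists y, z; apply: free5 => a b c d e r.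
  have [b0 c0] : b = 0 /\ c = 0.
    by apply: fyz; rewrite -(algM0r lam x) -r !algME anti_sq !L2 !scaler0 !addr0 add0r.
  have /xeig/eqP : x ** (d *: y + e *: z) = (- a) *: x.
    apply/eqP; rewrite !algME -subr_eq0 -[X in _ == X]r b0 c0; apply/eqP.
    by vring.
  rewrite oppr_eq0 => /eqP a0.
  have [-> ->] : d = 0 /\ e = 0.
    by apply: fyz; rewrite -[RHS]r a0 b0 c0 !scale0r !add0r.
  by split.
(* The third last nonzero term of the chain u, L u, L (L u), .. *)
have [y1 [y3 y2]] : exists y1, x ** (x ** (x ** y1)) = 0 /\ x ** (x ** y1) <> 0.
  have [m m0] := nilpotent_iter lam_nil.
  have ex : exists k, iter k (alg_mul lam x) u == 0 by exists m; rewrite m0.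
  case: (ex_minnP ex) => k /eqP k0 kmin.
  case: k k0 kmin => [|[|[|k]]] k0 kmin.
  - by case: u2; rewrite -[u]/(iter 0 (alg_mul lam x) u) k0 !algM0r.
  - by case: u2; rewrite /= in k0; rewrite k0 !algM0r.
  - by case: u2.
  exists (iter k (alg_mul lam x) u); split=> // /eqP k2.
  by have := kmin k.+2 k2; rewrite ltnn.
clear y z fyz u u2; move: y1 y2 y3 => y y2 y3.
set w1 := x ** y; set w2 := x ** w1.
have x_x := anti_sq x.
(* For the last coefficient: w2 = L w1 is not a multiple of x, by nilpotency. *)
have ind4 a b c d : a *: x + b *: y + c *: w1 + d *: w2 = 0 ->
    [/\ a = 0, b = 0, c = 0 & d = 0].
  move=> r.
  have r1 : b *: w1 + c *: w2 = 0.
    by rewrite -(algM0r lam x) -r !algME x_x y3 !scaler0 addr0 add0r.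
  have b0 : b = 0.
    apply: (scaler_cancel y2).
    by rewrite -(algM0r lam x) -r1 !algME y3 scaler0 addr0.
  have c0 : c = 0.
    by apply: (scaler_cancel y2); rewrite -[RHS]r1 b0 scale0r add0r.
  have /xeig/eqP : x ** (d *: w1) = (- a) *: x.
    rewrite !algME -/w2; apply/eqP; rewrite -subr_eq0 -[X in _ == X]r b0 c0.
    by apply/eqP; vring.
  rewrite oppr_eq0 => /eqP a0; split=> //.
  by apply: (scaler_cancel y2); rewrite -[RHS]r a0 b0 c0 !scale0r !add0r.
pose W := <<[:: x; y; w1; w2]>>%VS.
have Wst w : w \in W -> x ** w \in W.
  move=> /span4P[a [b [c [d ->]]]]; apply/span4P; exists 0, 0, b, c.
  by rewrite !algME x_x y3 -/w1 -/w2 !scaler0 !scale0r !add0r addr0.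
have [z zW] : exists z, z \notin W.
  exact: exists_notin_span.
have notW z1 c a b d e : z1 \notin W ->
    c *: z1 + (a *: x + b *: y + d *: w1 + e *: w2) = 0 -> c = 0.
  move=> z1W r; apply/eqP; apply: contraNT z1W => c0; apply/span4P.
  exists (- (a / c)), (- (b / c)), (- (d / c)), (- (e / c)).
  apply: (@scalerI _ _ c) => //; apply/eqP; rewrite -subr_eq0 -[X in _ == X]r.
  by apply/eqP/colP => i; rewrite !col_linE; field.
have [|xzW] := boolP (x ** z \in W); last first.
  exists y, z; apply: free5 => a b c d e r.
  have [c0|c0] := eqVneq c 0; last first.
    case/negP: zW; apply: (@stable_closed _ _ lam x z (- (e / c))) => //.
    apply/span4P; exists (- (a / c)), (- (b / c)), (- (d / c)), 0.
    apply: (@scalerI _ _ c) => //; apply/eqP; rewrite -subr_eq0 -[X in _ == X]r.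
    by apply/eqP/colP => i; rewrite !col_linE; field.
  have e0 : e = 0.
    by apply: (notW _ _ a b d 0 xzW); rewrite -[RHS]r c0; vring.
  have [|-> -> -> _] := ind4 a b d 0; last by split.
  by rewrite -[RHS]r c0 e0; vring.
case/span4P => al [be [ga [de zE]]].
(* Removing the part of L z that already comes from y and w1. *)
pose z' := z - ga *: y - de *: w1.
have z'W : z' \notin W.
  apply: contra zW => /span4P[a [b [c [d e]]]]; apply/span4P.
  by exists a, (b + ga), (c + de), d; rewrite -[z](subrK (ga *: y))
     -[z - _](subrK (de *: w1)) -/z' e; vring.
have z'E : x ** z' = al *: x + be *: y.
  by rewrite /z' !algME zE -/w1 -/w2; vring.
have [be0|be0] := eqVneq be 0.
  have al0 : al = 0 by apply: (xeig _ z'); rewrite z'E be0 scale0r addr0.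
  exists y, (w1 + z'); apply: free5 => a b c d e r.
  have xz : x ** (w1 + z') = w2 by rewrite algMDr z'E be0 al0 !scale0r !addr0.
  rewrite xz -/w1 in r.
  have c0 : c = 0 by apply: (notW _ _ a b (c + d) e z'W); rewrite -[RHS]r; vring.
  have [|-> -> d0 ->] := ind4 a b (c + d) e; first by rewrite -[RHS]r c0; vring.
  by split=> //; rewrite -d0 c0 add0r.
exists z', w1; apply: free5 => a b c d e; rewrite z'E -/w2 => r.
have b0 : b = 0.
  by apply: (notW _ _ (a + d * al) (d * be) c e z'W); rewrite -[RHS]r; vring.
have [|a0 d0 -> ->] := ind4 (a + d * al) (d * be) c e.
  by rewrite -[RHS]r b0; vring.
move/eqP: d0; rewrite mulf_eq0 (negPf be0) orbF => /eqP d0.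
by move: a0; rewrite d0 mul0r addr0.
Qed.

Lemma anti_degenerates_n52 x y z :
  free [:: x ** y; x ** z] -> degenerates lam n52.
Proof.
case/anti_pair_image => y' [z' f].
rewrite n52E; apply: (@degenerates_star _ _ lam x [:: y'; z']) => //.
exact: anti_sq.
Qed.

(** Fix x y = v nonzero. By hypothesis any p with p x or p y nonzero has all its products on the line
    of v; if both vanish, this applies to p + x in place of p. *)
Lemma anti_line x y :
    (forall x y z, ~ free [:: x ** y; x ** z]) -> x ** y <> 0 ->
  forall p q, exists k, p ** q = k *: (x ** y).
Proof.
move=> nf xy0; set v := x ** y.
have dep a b : a ** b <> 0 -> forall c, exists k, a ** c = k *: (a ** b).
  move=> ab0 c; have := nf a c b; rewrite free_cons seq1_free span_seq1.
  have -> : a ** b != 0 by apply/eqP.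
  by rewrite andbT => /negP; rewrite negbK => /vlineP.
have [kx hx] := choice (dep x y xy0).
have [ky hy] : exists ky, forall c, y ** c = ky c *: v.
  have yx0 : y ** x <> 0 by rewrite anti -/v => /eqP; rewrite oppr_eq0 => /eqP.
  have [k hk] := choice (dep y x yx0).
  by exists (fun c => - k c) => c; rewrite hk anti scalerN scaleNr.
have line_l p a k q : p ** a = k *: v -> p ** a <> 0 -> exists l, p ** q = l *: v.
  by move=> pa /dep /(_ q)[l ->]; exists (l * k); rewrite pa scalerA.
move=> p q.
have [px|px] := pselect (p ** x = 0); last first.
  by apply: (line_l p x (- kx p)) => //; rewrite anti hx scaleNr.
have [py|py] := pselect (p ** y = 0); last first.
  by apply: (line_l p y (- ky p)) => //; rewrite anti hy scaleNr.
have pxy : (p + x) ** y = 1 *: v by rewrite algMDl py add0r scale1r.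
have [|l hl] := line_l (p + x) y 1 q pxy; first by rewrite pxy scale1r.
exists (l - kx q); rewrite scalerBl -hl -hx algMDl.
by rewrite addrK.
Qed.

(** If some multiplication operator has rank two, the previous lemmas give n52. Otherwise all
    products lie on a line, and lam is an alternating form om with values on that line: of rank two,
    which is n3, or of rank at least four, when two symplectic pairs give n51. *)
Lemma anti_iso_n3_or_degenerates :
    lam <> abelian_alg K n ->
  [\/ isomorphic lam (n3 K n), degenerates lam n51 | degenerates lam n52].
Proof.
move=> lam0.
have [[x [y [z f]]]|nf] := pselect (exists x y z, free [:: x ** y; x ** z]).
  by constructor 3; apply: anti_degenerates_n52 f.
have {}nf x y z : ~ free [:: x ** y; x ** z] by move=> f; apply: nf; exists x, y, z.
have [x [y xy0]] : exists x y, x ** y <> 0.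
  apply: contrapT => h; apply: lam0; apply: algM_eq0 => x y.
  by apply: contrapT => xy; apply: h; exists x, y.
have line := anti_line nf xy0; set v := x ** y in xy0 line.
have vr z : z ** v = 0.
  have [k zv] := line z v; rewrite zv; exact: nilpotent_eigenl zv.
have vl z : v ** z = 0 by rewrite anti vr oppr0.
have [F dF] := free_dual (anti_free3 xy0).
have [_ dE] := dF.
pose om p q := (F`_2 *m (p ** q)) 0 0.
have omE p q : p ** q = om p q *: v.
  have [k pq] := line p q; rewrite /om pq -scalemxAr colZE.
  by have := dE 2%N 2%N isT isT; rewrite /= -/v => ->; rewrite mulr1.
have [Mb Mbe] := algM_mxr lam y; have [Mc Mce] := algM_mxl lam x.
pose be := F`_2 *m Mb; pose ga := F`_2 *m Mc.
have beE z : (be *m z) 0 0 = om z y by rewrite /be /om Mbe mulmxA.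
have gaE z : (ga *m z) 0 0 = om x z by rewrite /ga /om Mce mulmxA.
have [rk2|] := pselect (forall p q, om p q = om p y * om x q - om x p * om q y).
  constructor 1; apply: (@iso_form _ _ lam 2 [:: be; ga; F`_2] [:: x; y; v]) => //.
    split=> // -[|[|[|a]]] [|[|[|b]]] //= _ _; rewrite ?beE ?gaE.
    - by have := dE 2%N 2%N isT isT.
    - by rewrite /om anti_sq mulmx0 mxE.
    - by rewrite /om vl mulmx0 mxE.
    - by rewrite /om anti_sq mulmx0 mxE.
    - by have := dE 2%N 2%N isT isT.
    - by rewrite /om vr mulmx0 mxE.
    - by have := dE 2%N 0%N isT isT.
    - by have := dE 2%N 1%N isT isT.
    - by have := dE 2%N 2%N isT isT.
  move=> p q; rewrite !big_ord_recl !big_ord0 /form2 /= omE rk2 !beE !gaE.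
  by congr (_ *: _); ring.
move=> nrk; constructor 2.
have [p [q pq]] : exists p q, om p q <> om p y * om x q - om x p * om q y.
  apply: contrapT => h; apply: nrk => p q; apply: contrapT => pq.
  by apply: h; exists p, q.
set k := om p q - (om p y * om x q - om x p * om q y).
have k0 : k != 0 by rewrite subr_eq0; apply/eqP.
have omA a b : om b a = - om a b by rewrite /om anti mulmxN colNE.
(* The projection onto the orthogonal of the plane of x and y for om. *)
have [pr prE] : exists pr : 'cV[K]_n -> 'cV[K]_n,
    forall z, pr z = z - om z y *: x - om x z *: y by eexists.
have xpr z : x ** pr z = 0.
  by rewrite prE !algME anti_sq -/v [x ** z]omE; vring.
have ypr z : y ** pr z = 0.
  by rewrite prE !algME anti_sq [y ** x]anti -/v [y ** z]omE (omA z y); vring.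
have prx z : pr z ** x = 0 by rewrite anti xpr oppr0.
have pry z : pr z ** y = 0 by rewrite anti ypr oppr0.
have [q' q'E] : exists q', q' = k^-1 *: pr q by eexists.
have pq' : pr p ** q' = v.
  have e : pr p ** pr q = k *: v.
    rewrite [pr q]prE !algME prx pry !scaler0 !subr0 prE !algME.
    by rewrite [x ** q]omE [y ** q]omE [p ** q]omE (omA q y) /k; vring.
  by rewrite q'E algMZr e scalerA mulVf // scale1r.
have xq' : x ** q' = 0 by rewrite q'E algMZr xpr scaler0.
have yq' : y ** q' = 0 by rewrite q'E algMZr ypr scaler0.
apply: (@degenerates_n51 _ _ lam x y (pr p) q' v) => //.
- by move=> z _; apply: anti_sq.
apply: free5 => a b c d e r.
have yx : y ** x = - v by rewrite anti.
have b0 : b = 0.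
  apply: (scaler_cancel xy0).
  by rewrite -(algM0r lam x) -r !algME anti_sq xpr xq' vr; vring.
have a0 : a = 0.
  apply/eqP; rewrite -oppr_eq0; apply/eqP; apply: (scaler_cancel xy0).
  by rewrite -(algM0r lam y) -r !algME anti_sq ypr yq' vr yx; vring.
have d0 : d = 0.
  apply: (scaler_cancel xy0).
  by rewrite -(algM0r lam (pr p)) -r !algME anti_sq prx pry vr pq'; vring.
have c0 : c = 0.
  apply: (scaler_cancel xy0).
  by rewrite -(algM0l lam q') -r !algME anti_sq xq' yq' vl pq'; vring.
split=> //; apply: (scaler_cancel xy0).
by rewrite -[RHS]r a0 b0 c0 d0; vring.
Qed.

End Anticommutative.

(** * Lines in the space of matrices and generic points of an orbit *)

Section OrbitLine.
Variables (K : numFieldType) (n : nat).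
Implicit Types (lam mu nu : alg K n) (B : 'M[K]_n).

Lemma iso_scale nu (t : K) : t != 0 -> isomorphic nu [ffun ijk => t * nu ijk].
Proof.
move=> t0; have := iso_torus nu (fun=> 1%N) t0; congr isomorphic.
by apply/ffunP => ijk; rewrite !ffunE expr1; field.
Qed.

(** Join two bases by a line B0 + t (B1 - B0) in the space of matrices. The structure constants along
    the line, multiplied by the determinant D, are polynomials in t because the inverse becomes
    the adjugate; rescaling all structure constants does not change the isomorphism class. *)
Lemma orbit_line lam mu0 mu1 : isomorphic lam mu0 -> isomorphic lam mu1 ->
  exists (P : 'I_n * 'I_n * 'I_n -> {poly K}) (D : {poly K}),
    [/\ D.[0] != 0, D.[1] != 0,
        forall t, D.[t] != 0 -> isomorphic lam [ffun ijk => (P ijk).[t]],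
        forall ijk, (P ijk).[0] = D.[0] * mu0 ijk
      & forall ijk, (P ijk).[1] = D.[1] * mu1 ijk].
Proof.
move=> [g0 u0 ->] [g1 u1 ->]; set B0 := invmx g0; set B1 := invmx g1.
pose H : 'M[{poly K}]_n := map_mx polyC B0 + 'X *: map_mx polyC (B1 - B0).
pose Hat t := B0 + t *: (B1 - B0).
have HE t : map_mx (horner_eval t) H = Hat t.
  by apply/matrixP => i j; rewrite !mxE /horner_eval !hornerE.
pose P ijk : {poly K} := \sum_l \adj H ijk.2 l *
  \sum_a \sum_b H a ijk.1.1 * H b ijk.1.2 * (lam (a, b, l))%:P.
have DE t : (\det H).[t] = \det (Hat t).
  by rewrite -HE det_map_mx.
have PE t ijk : Hat t \in unitmx -> (P ijk).[t] = (\det H).[t] * sconst lam (Hat t) ijk.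
  move=> uH; case: ijk => [[i j] k]; rewrite sconstE // /invmx uH.
  rewrite -HE det_map_mx -map_mx_adj.
  have d0 : (\det H).[t] != 0 by rewrite DE -unitfE -unitmxE.
  rewrite [in RHS]mxE mulr_sumr horner_sum; apply: eq_bigr => l _.
  have -> : row k ((\det H).[t]^-1 *: map_mx (horner_eval t) (\adj H)) 0 l
            = (\det H).[t]^-1 * (\adj H k l).[t] by rewrite 3!mxE.
  rewrite hornerM 2!mulrA mulfV // mul1r [alg_mul _ _ _ _ _]mxE.
  congr (_ * _); rewrite horner_sum; apply: eq_bigr => a _.
  by rewrite horner_sum; apply: eq_bigr => b _; rewrite !hornerM hornerC !mxE.
have H0 : Hat 0 = B0 by rewrite /Hat scale0r addr0.
have H1 : Hat 1 = B1 by rewrite /Hat scale1r addrC subrK.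
have uB0 : B0 \in unitmx by rewrite unitmx_inv.
have uB1 : B1 \in unitmx by rewrite unitmx_inv.
exists P, (\det H); split=> [|||ijk|ijk].
- by rewrite DE H0 -unitfE -unitmxE.
- by rewrite DE H1 -unitfE -unitmxE.
- move=> t dt; have uH : Hat t \in unitmx by rewrite unitmxE unitfE -DE.
  have := iso_trans (iso_sconst lam uH) (iso_scale (sconst lam (Hat t)) dt).
  by congr isomorphic; apply/ffunP => ijk; rewrite [LHS]ffunE [RHS]ffunE PE.
- by rewrite PE H0 // /sconst invmxK.
- by rewrite PE H1 // /sconst invmxK.
Qed.

End OrbitLine.

Section Forms.
Variables (K : numFieldType) (n : nat) (hn : (5 <= n)%N).
Implicit Types (lam mu nu : alg K n) (x y z v : 'cV[K]_n).
Local Notation o0 := (o0 hn). Local Notation o1 := (o1 hn). Local Notation o2 := (o2 hn).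
Local Notation E i := (delta_mx i 0 : 'cV[K]_n).
Local Notation E' i := (delta_mx 0 i : 'rV[K]_n).

(** The four entries of the form that the multiplication induces on the first two basis vectors when
    only the coefficient of the third one is retained. *)
Definition entry11 mu := mu (o0, o0, o2).
Definition entry12 mu := mu (o0, o1, o2).
Definition entry21 mu := mu (o1, o0, o2).
Definition entry22 mu := mu (o1, o1, o2).
(** Changing the plane basis or the scale multiplies form_det and form_skew ^ 2 by the same factor, so
    form_det / form_skew ^ 2 classifies the non-symmetric forms that are not alternating. *)
Definition form_skew mu := entry12 mu - entry21 mu.
Definition form_det mu := entry11 mu * entry22 mu - entry12 mu * entry21 mu.

(** The form in the basis e_1, p e_1 + q e_2 of the plane, with values measured in units of e_1 e_1. *)
Lemma degenerates_form2 mu (p q : K) : entry11 mu != 0 -> q != 0 ->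
  let a := entry11 mu in let b := entry12 mu in let c := entry21 mu in let d := entry22 mu in
  degenerates mu (form_alg n 2 (form2 1 ((p * a + q * b) / a) ((p * a + q * c) / a)
    ((p ^+ 2 * a + p * q * (b + c) + q ^+ 2 * d) / a))).
Proof.
move=> a0 q0 a b c d; rewrite -/a in a0.
pose F := [:: E' o0 - (p / q) *: E' o1; q^-1 *: E' o1; a^-1 *: E' o2].
pose X := [:: E o0; p *: E o0 + q *: E o1; a *: E o2].
have E'E i (v : 'cV[K]_n) : (E' i *m v) 0 0 = v i 0 by rewrite -rowE mxE.
have dFX : dual_families F X.
  split=> // -[|[|[|s]]] [|[|[|t]]] //= _ _;
    rewrite ?mulmxBl -?scalemxAl ?col_linE !E'E !mxE -!(inj_eq val_inj) /=; field; by rewrite ?q0 ?a0.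
have := @degenerates_form _ _ mu _ _ _ dFX erefl.
congr degenerates; apply: eq_form_alg.
have e i j : (E' o2 *m alg_mul mu (E i) (E j)) 0 0 = mu (i, j, o2).
  by rewrite E'E algM_delta.
move=> [|[|i]] [|[|j]] //= _ _; rewrite /form2 /= ?algME ?mulmxDr -?scalemxAr
   -?scalemxAl ?col_linE ?e -/a -/b -/c -/d.
 
all: by rewrite -?[mu (o0, o0, o2)]/a -?[mu (o0, o1, o2)]/b -?[mu (o1, o0, o2)]/c
     -?[mu (o1, o1, o2)]/d; field.
Qed.

(** Choose the second vector y of the plane so that y e_1 = 0 for the form; by non-symmetry e_1 y is
    nonzero and can be normalized. *)
Lemma degenerates_L4 mu : entry11 mu != 0 -> form_skew mu != 0 ->
  degenerates mu (L4 (form_det mu / form_skew mu ^+ 2)).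
Proof.
move=> a0 s0; rewrite /form_skew in s0 *.
have := @degenerates_form2 mu (- entry21 mu / (entry12 mu - entry21 mu))
  (entry11 mu / (entry12 mu - entry21 mu)) a0.
rewrite mulf_neq0 ?invr_eq0 // => /(_ isT); rewrite L4E /form_det.
move: (entry11 mu) (entry12 mu) (entry21 mu) (entry22 mu) a0 s0 => a b c d a0 s0.
congr (degenerates _ (form_alg _ _ (form2 _ _ _ _))); field; by rewrite ?a0 ?s0.
Qed.

End Forms.

Section NonAnti.
Variables (K : numClosedFieldType) (n : nat) (hn : (5 <= n)%N).
Implicit Types (lam mu nu : alg K n) (x y z v : 'cV[K]_n).
Local Notation o0 := (o0 hn). Local Notation o1 := (o1 hn). Local Notation o2 := (o2 hn).
Local Notation c11 := (@entry11 K n hn). Local Notation c12 := (@entry12 K n hn).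
Local Notation c21 := (@entry21 K n hn). Local Notation c22 := (@entry22 K n hn).
Local Notation cskew := (@form_skew K n hn). Local Notation cdet := (@form_det K n hn).

(** A nondegenerate symmetric form has two isotropic lines; the second vector is taken on one of them,
    which is where the square root enters. *)
Lemma degenerates_L5 mu : c11 mu != 0 -> cskew mu = 0 -> cdet mu != 0 ->
  degenerates mu L5.
Proof.
move=> a0 /eqP; rewrite subr_eq0 /form_det => /eqP bc N0; rewrite -bc in N0.
have := sqrtCK (- (c11 mu * c22 mu - c12 mu * c12 mu)^-1).
set r := sqrtC _ => r2.
have r0 : r != 0 by rewrite -sqrf_eq0 r2 oppr_eq0 invr_eq0.
have := @degenerates_form2 _ _ hn mu (1 - r * c12 mu) (c11 mu * r) a0.
rewrite mulf_neq0 // -bc L5E => /(_ isT) /=.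
move: (c11 mu) (c12 mu) (c22 mu) a0 r2 N0 => a b d a0 r2 N0.
have e12 : ((1 - r * b) * a + a * r * b) / a = 1 by field.
rewrite e12; congr (degenerates _ (form_alg _ _ (form2 _ _ _ _))).
transitivity (1 + r ^+ 2 * (a * d - b * b)); first by field.
by rewrite r2 mulNr mulVf // subrr.
Qed.

Lemma regular_form_skew : regular_fun cskew.
Proof. by apply: regularD; [|apply: regularN]; apply: regular_coord. Qed.

Lemma regular_form_det : regular_fun cdet.
Proof.
by apply: regularD; [|apply: regularN]; apply: regularM; apply: regular_coord.
Qed.

Lemma orbit_line_invariants lam mu0 mu1 : isomorphic lam mu0 -> isomorphic lam mu1 ->
  exists A M N D : {poly K},
    [/\ D != 0,
       (forall t, D.[t] != 0 -> exists2 mu, isomorphic lam mu &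
          [/\ c11 mu = A.[t], cskew mu = M.[t] & cdet mu = N.[t]]),
       (exists2 s, s != 0 &
          [/\ A.[0] = s * c11 mu0, M.[0] = s * cskew mu0 & N.[0] = s ^+ 2 * cdet mu0])
     & (exists2 s, s != 0 &
          [/\ A.[1] = s * c11 mu1, M.[1] = s * cskew mu1 & N.[1] = s ^+ 2 * cdet mu1])].
Proof.
move=> i0 i1; have [P [D [D0 D1 iP P0 P1]]] := orbit_line i0 i1.
exists (P (o0, o0, o2)), (P (o0, o1, o2) - P (o1, o0, o2)),
  (P (o0, o0, o2) * P (o1, o1, o2) - P (o0, o1, o2) * P (o1, o0, o2)), D.
rewrite /entry11 /form_skew /form_det /entry11 /entry12 /entry21 /entry22; split.
- by apply: contraNneq D0 => ->; rewrite horner0.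
- move=> t /iP it; eexists; first exact: it.
  by rewrite !ffunE !hornerE.
- by exists D.[0] => //; split; rewrite ?hornerE ?P0; ring.
- by exists D.[1] => //; split; rewrite ?hornerE ?P1; ring.
Qed.

(** Two nonzero polynomials in t have a common non-root. *)
Lemma exists_entry11_skew lam mu0 mu1 :
    isomorphic lam mu0 -> isomorphic lam mu1 -> c11 mu0 != 0 -> cskew mu1 != 0 ->
  exists2 mu, isomorphic lam mu & c11 mu != 0 /\ cskew mu != 0.
Proof.
move=> i0 i1 a0 m1.
have [A [M [N [D [D0 iD [s s0 [As Ms Ns]] [s' s'0 [As' Ms' Ns']]]]]]] :=
  orbit_line_invariants i0 i1.
have A0 : A != 0.
  by apply: contraNneq (mulf_neq0 s0 a0) => e; rewrite -As e horner0.
have M0 : M != 0.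
  by apply: contraNneq (mulf_neq0 s'0 m1) => e; rewrite -Ms' e horner0.
have [t] := exists_nonroot (mulf_neq0 (mulf_neq0 A0 M0) D0).
rewrite !rootM !negb_or => /andP[/andP[At Mt] /iD[mu i [eA eM _]]].
by exists mu; rewrite ?eA ?eM.
Qed.

Lemma exists_entry11_det lam mu0 mu1 :
    isomorphic lam mu0 -> isomorphic lam mu1 -> c11 mu0 != 0 -> cdet mu1 != 0 ->
  exists2 mu, isomorphic lam mu & c11 mu != 0 /\ cdet mu != 0.
Proof.
move=> i0 i1 a0 n1.
have [A [M [N [D [D0 iD [s s0 [As Ms Ns]] [s' s'0 [As' Ms' Ns']]]]]]] :=
  orbit_line_invariants i0 i1.
have A0 : A != 0.
  by apply: contraNneq (mulf_neq0 s0 a0) => e; rewrite -As e horner0.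
have N0 : N != 0.
  by apply: contraNneq (mulf_neq0 (expf_neq0 2 s'0) n1) => e; rewrite -Ns' e horner0.
have [t] := exists_nonroot (mulf_neq0 (mulf_neq0 A0 N0) D0).
rewrite !rootM !negb_or => /andP[/andP[At Nt] /iD[mu i [eA _ eN]]].
by exists mu; rewrite ?eA ?eN.
Qed.

(** The algebras L4 form a line in the space of algebras. *)
Lemma degenerates_L4_dense lam (beta : K) :
    (forall q : {poly K}, (forall al, degenerates lam (L4 al) -> root q al) -> q = 0) ->
  degenerates lam (L4 beta).
Proof.
pose P ijk : {poly K} := (L4 0 : alg K n) ijk *: 1 + (L4 1 ijk - (L4 0 : alg K n) ijk) *: 'X.
have PE t : L4 t = [ffun ijk => (P ijk).[t]].
  apply/ffunP => -[[i j] k]; rewrite [RHS]ffunE /P !hornerE !L4E !ffunE /= /form2.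
  by do ![case: ifP => _] => //=; ring.
by move=> h; rewrite PE; apply: degenerates_curve => q rq; apply: h => al; rewrite PE; apply: rq.
Qed.

(** The ratio form_det / form_skew ^ 2 equals 1/4 at n3. If it is equal to a constant al0 on the whole
    orbit of lam, then this closed condition holds at n3 and al0 = 1/4. Otherwise the ratio is not
    constant along some line of bases, so it takes infinitely many values al at points of that line
    where entry11 and form_skew are nonzero; lam degenerates to L4 al for all of them, and therefore
    for every al. *)
Lemma degenerates_n3_L4 lam mu0 : isomorphic lam mu0 -> c11 mu0 != 0 ->
  degenerates lam (n3 K n) -> degenerates lam (L4 (4%:R^-1)).
Proof.
move=> i0 a0 /degeneratesP d3.
have n4 : 4%:R != 0 :> K by rewrite pnatr_eq0.
have n3E : [/\ c12 (n3 K n) = 1, c21 (n3 K n) = -1 & c11 (n3 K n) = 0].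
  by rewrite /entry12 /entry21 /entry11 !ffunE.
case: n3E => e12 e21 e11.
have skew3 : cskew (n3 K n) = 2%:R by rewrite /form_skew e12 e21; ring.
have det3 : cdet (n3 K n) = 1 by rewrite /form_det e12 e21 e11; ring.
have [mu1 i1 m1] : exists2 mu1, isomorphic lam mu1 & cskew mu1 != 0.
  apply: contrapT => h; have : cskew (n3 K n) = 0.
    apply: (d3 _ regular_form_skew) => nu i; apply: contrapT => /eqP nz.
    by apply: h; exists nu.
  by move/eqP; rewrite skew3 pnatr_eq0.
have [mu2 i2 [a2 m2]] := exists_entry11_skew i0 i1 a0 m1.
set al0 := cdet mu2 / cskew mu2 ^+ 2.
have L4mu mu : isomorphic lam mu -> c11 mu != 0 -> cskew mu != 0 ->
    degenerates lam (L4 (cdet mu / cskew mu ^+ 2)).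
  move=> i a s; apply: degenerates_iso (iso_sym i) (iso_refl _) _.
  exact: degenerates_L4.
have [e|al0_ne] := eqVneq al0 4%:R^-1; first by rewrite -e; apply: L4mu.
pose f mu := cdet mu - al0 * cskew mu ^+ 2.
have rf : regular_fun f.
  apply: regularD; first exact: regular_form_det.
  apply: regularN; apply: regularM; first exact: regular_cst.
  by apply: regularM; exact: regular_form_skew.
have [mu3 i3 f3] : exists2 mu3, isomorphic lam mu3 & f mu3 != 0.
  apply: contrapT => h.
  have : f (n3 K n) = 0.
    apply: (d3 _ rf) => nu i; apply: contrapT => /eqP nz.
    by apply: h; exists nu.
  rewrite /f skew3 det3 => /eqP; rewrite subr_eq0 => /eqP e; case/eqP: al0_ne.
  by apply: (mulIf n4); rewrite mulVf // [RHS]e; ring.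
have [A [M [N [D [D0 iD [s s0 [As Ms Ns]] [s' s'0 [As' Ms' Ns']]]]]]] :=
  orbit_line_invariants i2 i3.
have A0 : A != 0.
  by apply: contraNneq (mulf_neq0 s0 a2) => e; rewrite -As e horner0.
have M0 : M != 0.
  by apply: contraNneq (mulf_neq0 s0 m2) => e; rewrite -Ms e horner0.
apply: degenerates_L4_dense => q rq; apply/eqP; apply: contraT => q0.
(* Almost all values of N / M ^ 2 are among the finitely many roots of q, so that it is constant. *)
have [r qE] := closed_field_poly_normal q.
have : \prod_(z <- r) (N - z *: M ^+ 2) = 0.
  apply: (poly0_off_roots (mulf_neq0 (mulf_neq0 A0 M0) D0)) => t.
  rewrite !rootM !negb_or => /andP[/andP[At Mt] /iD[mu i [eA eM eN]]].
  have : root q (cdet mu / cskew mu ^+ 2).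
    by apply: rq; apply: L4mu; rewrite ?eA ?eM.
  rewrite eM eN qE rootZ ?lead_coef_eq0 // root_prod_XsubC => zr.
  rewrite /root horner_prod prodf_seq_eq0; apply/hasP; exists (N.[t] / M.[t] ^+ 2) => //.
  by rewrite /= hornerD hornerN hornerZ horner_exp mulfVK ?subrr // expf_neq0.
move/eqP; rewrite prodf_seq_eq0 => /hasP[z _ /= /eqP NzM].
have z_al0 : z = al0.
  have := congr1 (horner ^~ 0) NzM; rewrite /= hornerD hornerN hornerZ horner_exp horner0 Ns Ms => /eqP.
  rewrite subr_eq0 exprMn mulrCA => /eqP /(mulfI (expf_neq0 2 s0)) e.
  by rewrite /al0 e mulfK // expf_neq0.
have := congr1 (horner ^~ 1) NzM; rewrite /= hornerD hornerN hornerZ horner_exp horner0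
  Ns' Ms' z_al0 => /eqP.
rewrite exprMn mulrCA -mulrBr mulf_eq0 sqrf_eq0 (negPf s'0) /= => f30.
by rewrite -/(f mu3) (negPf f3) in f30.
Qed.

End NonAnti.

(** * Commutative nilpotent algebras that degenerate to no nondegenerate form *)

Section OrbitPoints.
Variables (K : numClosedFieldType) (n : nat) (hn : (5 <= n)%N).
Implicit Types (lam mu nu : alg K n) (x y z v : 'cV[K]_n).
Local Notation o0 := (o0 hn). Local Notation o1 := (o1 hn). Local Notation o2 := (o2 hn).
Local Notation c11 := (@entry11 K n hn). Local Notation c12 := (@entry12 K n hn).
Local Notation c21 := (@entry21 K n hn). Local Notation c22 := (@entry22 K n hn).
Local Notation cskew := (@form_skew K n hn). Local Notation cdet := (@form_det K n hn).

(** Here phi is any form vanishing on x and y, so that the third row of the dual basis can be chosen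
    freely on the rest of the space. *)
Lemma orbit_point lam x y z (phi : 'rV[K]_n) : free [:: x; y; z] ->
    (phi *m x) 0 0 = 0 -> (phi *m y) 0 0 = 0 -> (phi *m z) 0 0 = 1 ->
  exists2 mu, isomorphic lam mu &
    [/\ c11 mu = (phi *m alg_mul lam x x) 0 0, c12 mu = (phi *m alg_mul lam x y) 0 0,
        c21 mu = (phi *m alg_mul lam y x) 0 0 & c22 mu = (phi *m alg_mul lam y y) 0 0].
Proof.
move=> fr px py pz; have [F [_ dF]] := free_dual fr.
have dG : dual_families [:: F`_0; F`_1; phi] [:: x; y; z].
  by split=> // -[|[|[|a]]] [|[|[|b]]] //= _ _; rewrite ?px ?py ?pz //;
    [apply: (dF 0%N 0%N) | apply: (dF 0%N 1%N) | apply: (dF 0%N 2%N)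
    | apply: (dF 1%N 0%N) | apply: (dF 1%N 1%N) | apply: (dF 1%N 2%N)].
have [B uB [cB rB]] := dual_completion dG.
exists (sconst lam B); first exact: iso_sconst.
by rewrite /entry11 /entry12 /entry21 /entry22 !sconstE // (rB o2) // (cB o0) // (cB o1).
Qed.

Lemma square_free lam x : nilpotent_alg lam -> alg_mul lam x x <> 0 ->
  free [:: x; alg_mul lam x x].
Proof.
move=> nl xx; rewrite free_cons seq1_free span_seq1; apply/andP; split; last exact/eqP.
apply/negP => /vlineP[k xE]; apply: xx.
have [k0|k0] := eqVneq k 0.
  have x0 : x = 0 by rewrite xE k0 scale0r.
  by rewrite x0 algM0l.
have e : alg_mul lam x x = k^-1 *: x by rewrite [in RHS]xE scalerA mulVf // scale1r.
by rewrite e; apply: nilpotent_eigenl nl e.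
Qed.

Lemma exists_entry11 lam x : nilpotent_alg lam -> alg_mul lam x x <> 0 ->
  exists2 mu, isomorphic lam mu & c11 mu != 0.
Proof.
move=> nl xx; have fx := square_free nl xx.
have [y yW] : exists y, y \notin <<[:: x; alg_mul lam x x]>>%VS.
  by apply: exists_notin_span; apply: leq_trans hn.
have fr : free [:: x; y; alg_mul lam x x].
  have -> : free [:: x; y; alg_mul lam x x] = free [:: y; x; alg_mul lam x x].
    by apply: perm_free; rewrite -[_ :: _]/([:: x; y] ++ [:: _])
      -[X in perm_eq _ X]/([:: y; x] ++ [:: _]) perm_cat2r (perm_catC [:: x] [:: y]).
  by rewrite free_cons yW.
have [F [_ dF]] := free_dual fr.
have [mu i [e11 _ _ _]] := orbit_point lam fr
  (dF 2%N 0%N isT isT) (dF 2%N 1%N isT isT) (dF 2%N 2%N isT isT).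
by exists mu; rewrite // e11 (dF 2%N 2%N isT isT) oner_eq0.
Qed.

End OrbitPoints.

Section Symmetric.
Variables (K : numClosedFieldType) (n : nat) (hn : (5 <= n)%N) (lam : alg K n).
Implicit Types (x y z v : 'cV[K]_n).
Local Notation cskew := (@form_skew K n hn). Local Notation cdet := (@form_det K n hn).
Local Notation "x ** y" := (alg_mul lam x y) (at level 40, left associativity).
Hypothesis lam_nil : nilpotent_alg lam.
Hypothesis skew0 : forall mu, isomorphic lam mu -> cskew mu = 0.
Hypothesis det0 : forall mu, isomorphic lam mu -> cdet mu = 0.

(** Otherwise x, y and [x, y] are independent, and the form that reads off the coefficient of [x, y]
    is not symmetric. *)
Lemma comm_of_skew0 x y : x ** y = y ** x.
Proof.
apply: contrapT => xy; have w0 : x ** y - y ** x <> 0.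
  by move/eqP; rewrite subr_eq0 => /eqP.
have fr := commutator_free lam_nil w0; have [F [_ dF]] := free_dual fr.
have [mu i [_ e12 e21 _]] := @orbit_point _ _ hn lam x y _ F`_2 fr
  (dF 2%N 0%N isT isT) (dF 2%N 1%N isT isT) (dF 2%N 2%N isT isT).
have := skew0 i; rewrite /form_skew e12 e21.
have := dF 2%N 2%N isT isT; rewrite /= mulmxBr colDE colNE => -> /eqP.
by rewrite oner_eq0.
Qed.

(** On any plane killed by phi the symmetric form phi (x y) has rank at most one. The next lemmas
    use this with suitable choices of phi. *)
Lemma det0_form x y z (phi : 'rV[K]_n) : free [:: x; y; z] ->
    (phi *m x) 0 0 = 0 -> (phi *m y) 0 0 = 0 -> (phi *m z) 0 0 = 1 ->
  (phi *m (x ** x)) 0 0 * (phi *m (y ** y)) 0 0 = (phi *m (x ** y)) 0 0 ^+ 2.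
Proof.
move=> fr px py pz; have [mu i [e11 e12 e21 e22]] := orbit_point hn lam fr px py pz.
have := det0 i; rewrite /form_det e11 e12 e21 e22 (comm_of_skew0 y x) => /eqP.
by rewrite subr_eq0 expr2 => /eqP.
Qed.

(** With y = x x and phi reading off x y, the left-hand side of det0_form vanishes and the
    right-hand side is 1. *)
Lemma square_annihilates x : x ** (x ** x) = 0.
Proof.
apply: contrapT => w0; have fr := square_chain_free lam_nil w0.
have [F [_ dF]] := free_dual fr.
have := @det0_form _ _ _ F`_2 fr (dF 2%N 0%N isT isT) (dF 2%N 1%N isT isT) (dF 2%N 2%N isT isT).
have := dF 2%N 2%N isT isT; have := dF 2%N 1%N isT isT; rewrite /= => -> ->.
by rewrite mul0r expr1n => /eqP; rewrite eq_sym oner_eq0.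
Qed.

(** First x y lies in the span of x, y and x x, since otherwise some phi sees x y but not x x. The
    coefficients of y and x then vanish by nilpotency. *)
Lemma mul_in_square_line x : x ** x <> 0 -> forall y, exists b, x ** y = b *: (x ** x).
Proof.
move=> xx0 y; set u := x ** x in xx0 *.
have xu : x ** u = 0 := square_annihilates x.
have inW v : v \in <<[:: x; u]>>%VS <-> exists a b, v = a *: x + b *: u.
  rewrite !span_cons span_nil addv0; split.
    by case/memv_addP => _ /vlineP[a ->] [_ /vlineP[b ->] ->]; exists a, b.
  by case=> a [b ->]; apply: memv_add; apply: memvZ; apply: memv_line.
have [|yW] := boolP (y \in <<[:: x; u]>>%VS).
  by move=> /inW[a [b ->]]; exists a; rewrite !algME xu scaler0 addr0.
have x0 : x <> 0 by move=> x0; apply: xx0; rewrite /u x0 algM0l.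
have fxu : free [:: x; u].
  apply/free2P => a b e.
  have a0 : a = 0.
    by apply: (scaler_cancel xx0); rewrite -(algM0r lam x) -e !algME xu scaler0 addr0.
  by split=> //; apply: (scaler_cancel xx0); rewrite -[RHS]e a0 scale0r add0r.
have [a [c [b xyE]]] : exists a c b, x ** y = a *: x + c *: y + b *: u.
  apply: contrapT => h.
  have fr4 : free ([:: x; y; x ** y] ++ [:: u]).
    have -> : free ([:: x; y; x ** y] ++ [:: u]) = free [:: x ** y; y; x; u].
      by apply: perm_free; rewrite -[[:: x ** y; y; x; u]]/(rev [:: x; y; x ** y] ++ [:: u])
        perm_cat2r perm_sym perm_rev.
    rewrite free_cons [free (y :: _)]free_cons yW fxu !andbT.
    apply/negP; rewrite span_cons => /memv_addP[_ /vlineP[c ->] [_ /inW[a [b ->]] e]].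
    by apply: h; exists a, c, b; rewrite e; vring.
  have fr := catl_free fr4; have [F [_ dF]] := free_dual fr4.
  have := @det0_form _ _ _ F`_2 fr (dF 2%N 0%N isT isT) (dF 2%N 1%N isT isT) (dF 2%N 2%N isT isT).
  have := dF 2%N 3%N isT isT; have := dF 2%N 2%N isT isT; rewrite /= => -> ->.
  by rewrite mul0r expr1n => /eqP; rewrite eq_sym oner_eq0.
have c0 : c = 0.
  apply/eqP; apply: contraNT yW => c0.
  apply: (@stable_closed _ _ lam x y c^-1) => // [w /inW[p [q ->]]|].
    by apply/inW; exists 0, p; rewrite !algME xu; vring.
  apply/inW; exists (- (a / c)), (- (b / c)); rewrite xyE.
  by apply/colP => i; rewrite !col_linE; field.
have a0 : a = 0.
  apply: (scaler_cancel x0); apply: (@nilpotent_eigenl _ _ lam (y - b *: x)) => //.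
  by rewrite algMDl algMNl algMZl -comm_of_skew0 xyE c0 -/u; vring.
by exists b; rewrite xyE a0 c0; vring.
Qed.

(** All squares lie on the line of v = x x, by comparing two vectors and their sum; by polarization so
    do all products, and the resulting symmetric form has rank one: a vector z with x z = 0
    has square zero by det0_form in the plane of x and z. *)
Lemma iso_lam2 x : x ** x <> 0 -> isomorphic lam (lam2 K n).
Proof.
move=> xx0; set v := x ** x in xx0 *.
have sqv y : exists c, y ** y = c *: v.
  have [yy|yy] := pselect (y ** y = 0); first by exists 0; rewrite yy scale0r.
  have [b xy] := mul_in_square_line xx0 y; rewrite -/v in xy.
  have [b' yx] := mul_in_square_line yy x; rewrite comm_of_skew0 xy in yx.
  have [b'0|b'0] := eqVneq b' 0; last first.
    by exists (b / b'); rewrite mulrC -scalerA yx scalerA mulVf // scale1r.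
  have xy0 : x ** y = 0 by rewrite xy yx b'0 scale0r.
  have yx0 : y ** x = 0 by rewrite comm_of_skew0.
  have sq : (x + y) ** (x + y) = v + y ** y.
    by rewrite !algME xy0 yx0 addr0 add0r.
  have [s0|s0] := pselect (v + y ** y = 0).
    by exists (-1); rewrite scaleN1r; apply/eqP; rewrite -addr_eq0 addrC s0.
  have [|l] := @mul_in_square_line (x + y) _ x; first by rewrite sq.
  rewrite sq algMDl yx0 addr0 -/v => e.
  have l0 : l != 0 by apply: contra_not_neq xx0 => l0; rewrite e l0 scale0r.
  exists (l^-1 - 1); apply: (scalerI l0).
  by rewrite scalerA mulrBr mulfV // mulr1 scalerBl scale1r {1}e scalerDr addrAC subrr add0r.
have n2 : 2%:R != 0 :> K by rewrite pnatr_eq0.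
have xv : x ** v = 0 := square_annihilates x.
have x0 : x <> 0 by move=> x0; apply: xx0; rewrite /v x0 algM0l.
have fxv : free [:: x; v].
  apply/free2P => a b e.
  have a0 : a = 0.
    by apply: (scaler_cancel xx0); rewrite -(algM0r lam x) -e !algME xv scaler0 addr0.
  by split=> //; apply: (scaler_cancel xx0); rewrite -[RHS]e a0 scale0r add0r.
have [F [_ dF]] := free_dual fxv; have [M Me] := algM_mxl lam x.
have Fx : (F`_1 *m x) 0 0 = 0 := dF 1%N 0%N isT isT.
have Fv : (F`_1 *m v) 0 0 = 1 := dF 1%N 1%N isT isT.
pose be z := (F`_1 *m (x ** z)) 0 0.
have beE z : x ** z = be z *: v.
  have [b xz] := mul_in_square_line xx0 z.
  by rewrite /be xz -/v -scalemxAr colZE Fv mulr1.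
have sq0 z : x ** z = 0 -> z ** z = 0.
  move=> xz; have [c zz] := sqv z; rewrite zz.
  have [->|c0] := eqVneq c 0; first by rewrite scale0r.
  have zv : z ** v = 0.
    by apply: (scalerI c0); rewrite -algMZr -zz square_annihilates scaler0.
  have fr : free [:: x; z; v].
    apply/free3P => a b e r.
    have a0 : a = 0.
      by apply: (scaler_cancel xx0); rewrite -(algM0r lam x) -r !algME xz xv; vring.
    have b0 : b = 0.
      apply: (scaler_cancel xx0); apply: (scalerI c0); rewrite scaler0 scalerA mulrC -scalerA -zz.
      by rewrite -(algM0r lam z) -r !algME zv (comm_of_skew0 z x) xz; vring.
    by split=> //; apply: (scaler_cancel xx0); rewrite -[RHS]r a0 b0; vring.
  have [G [_ dG]] := free_dual fr.
  have := @det0_form _ _ _ G`_2 fr (dG 2%N 0%N isT isT) (dG 2%N 1%N isT isT) (dG 2%N 2%N isT isT).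
  have := dG 2%N 2%N isT isT; rewrite /= -/v zz -scalemxAr colZE => ->.
  by rewrite xz mulmx0 col0E expr0n mul1r mulr1 => ->; rewrite scale0r.
have mul0 p q : x ** p = 0 -> x ** q = 0 -> p ** q = 0.
  move=> xp xq; apply: (scalerI n2); rewrite scaler0.
  have : (p + q) ** (p + q) = 0 by apply: sq0; rewrite algMDr xp xq addr0.
  by rewrite !algME !sq0 // (comm_of_skew0 q p) addr0 add0r => e; rewrite -[RHS]e; vring.
have form p q : p ** q = (be p * be q) *: v.
  have kp z : x ** (z - be z *: x) = 0 by rewrite algMDr algMNr algMZr beE -/v subrr.
  have := mul0 _ _ (kp p) (kp q).
  rewrite !algME beE (comm_of_skew0 p x) beE -/v => e.
  by apply/eqP; rewrite -subr_eq0 -[X in _ == X]e; apply/eqP; vring.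
apply: (@iso_form _ _ lam 1 [:: F`_1 *m M; F`_1] [:: x; v]) => //.
  split=> // -[|[|a]] [|[|b]] //= _ _; rewrite -?mulmxA -?Me ?Fx ?Fv //.
  by rewrite xv mulmx0 col0E.
by move=> p q; rewrite !big_ord_recl !big_ord0 /= -!mulmxA -!Me form -/v /be; congr (_ *: _); ring.
Qed.

End Symmetric.

(** * Level two *)

Section LevelTwo.
Variables (K : numClosedFieldType) (n : nat) (hn : (5 <= n)%N).
Implicit Types (lam mu nu : alg K n) (x y z v : 'cV[K]_n).

Lemma anticomm_of_squares lam : (forall x, alg_mul lam x x = 0) ->
  forall x y, alg_mul lam y x = - alg_mul lam x y.
Proof.
move=> sq x y; have := sq (x + y).
by rewrite !algME !sq addr0 add0r => /eqP; rewrite addr_eq0 => /eqP ->; rewrite opprK.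
Qed.

(** A vector x with nonzero square gives lam2 via x and x x; otherwise lam is anticommutative and any
    nonzero product x y gives n3 via x, y and x y. *)
Lemma nilpotent_degenerates_n3_or_lam2 nu : nilpotent_alg nu -> nu <> abelian_alg K n ->
  degenerates nu (n3 K n) \/ degenerates nu (lam2 K n).
Proof.
move=> nnu nu0; have [[x xx]|nsq] := pselect (exists x, alg_mul nu x x <> 0).
  by right; apply: degenerates_lam2 (square_free nnu xx).
have sq x : alg_mul nu x x = 0 by apply: contrapT => xx; apply: nsq; exists x.
have an := anticomm_of_squares sq.
have [x [y xy]] : exists x y, alg_mul nu x y <> 0.
  apply: contrapT => h; apply: nu0; apply: algM_eq0 => x y.
  by apply: contrapT => xy; apply: h; exists x, y.
left; apply: (@degenerates_n3 _ _ _ x y) => //; exact: anti_free3.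
Qed.

Lemma degenerates_abelian_only mu : degenerates (abelian_alg K n) mu -> mu = abelian_alg K n.
Proof.
move/degeneratesP => d; apply/ffunP => ijk.
have -> : abelian_alg K n ijk = 0 by rewrite ffunE.
have := d _ (regular_coord _ ijk); apply=> nu /iso_sym/iso_abelian ->.
by rewrite ffunE.
Qed.

(** Having only zero squares is a closed condition, stable under isomorphism. *)
Lemma degenerates_lam2_square lam : degenerates lam (lam2 K n) ->
  exists x, alg_mul lam x x <> 0.
Proof.
move/degeneratesP => d; apply: contrapT => h.
have sq x : alg_mul lam x x = 0 by apply: contrapT => xx; apply: h; exists x.
have := d _ (regular_coord _ (o0 hn, o0 hn, o1 hn)).
rewrite ffunE /= => e; have /eqP : 1 = 0 :> K; last by rewrite oner_eq0.
apply: e => nu [g ug ->]; rewrite -algM_delta alg_mul_act sq mulmx0.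
by rewrite mxE.
Qed.

Lemma level_two_classification lam : nilpotent_alg lam -> has_level lam 2 ->
  [\/ isomorphic lam n51, isomorphic lam n52,
      exists alpha : K, isomorphic lam (L4 alpha)
    | isomorphic lam L5].
Proof.
move=> lam_nil [[c [c0 c2 cd]] _].
have := cd 0%N isT; have := cd 1%N isT; rewrite c0 c2 => {c0 c2 cd}.
move: (c 1%N) => nu {c} [_ nu_ab nu_dir] [lam_nu lam_niso lam_dir].
have nu_nil := degenerates_nilpotent lam_nu lam_nil.
have nu0 : nu <> abelian_alg K n by move=> e; apply: nu_ab; rewrite e; apply: iso_refl.
have lam0 : lam <> abelian_alg K n.
  by move=> e; apply: nu0; apply: degenerates_abelian_only; rewrite -e.
(* Directness of nu -> 0 leaves no room for T between them. *)
have nu_iso T : degenerates nu T -> T <> abelian_alg K n -> isomorphic T nu.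
  move=> nuT T0; apply: contrapT => Tnu; apply: nu_dir; exists T; split=> //.
    by move/iso_abelian.
  exact: degenerates_abelian.
(* Directness of lam -> nu leaves no room for T' between them. *)
have inter T T' : isomorphic T nu -> degenerates lam T' -> degenerates T' T ->
    ~ isomorphic T' T -> isomorphic lam T'.
  move=> Tnu lamT' T'T nT'T; apply: contrapT => nlamT'; apply: lam_dir.
  exists T'; split=> //.
  - by move/iso_sym.
  - by move=> T'nu; apply: nT'T; apply: iso_trans T'nu (iso_sym Tnu).
  - exact: degenerates_iso (iso_refl T') Tnu T'T.
have lamT T : isomorphic T nu -> degenerates lam T.
  by move=> Tnu; apply: degenerates_iso (iso_refl lam) (iso_sym Tnu) lam_nu.
case: (nilpotent_degenerates_n3_or_lam2 nu_nil nu0) => [/nu_iso|/nu_iso] Tnu.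
  have {}Tnu := Tnu (n3_neq0 hn).
  have [[x xx]|nsq] := pselect (exists x, alg_mul lam x x <> 0).
    have [mu0 i0 a0] := exists_entry11 hn lam_nil xx.
    constructor 3; exists 4%:R^-1; apply: (inter _ _ Tnu).
    - exact: degenerates_n3_L4 i0 a0 (lamT _ Tnu).
    - exact: L4_degenerates_n3.
    - exact: L4_niso_n3.
  have sq x : alg_mul lam x x = 0 by apply: contrapT => xx; apply: nsq; exists x.
  case: (anti_iso_n3_or_degenerates hn lam_nil (anticomm_of_squares sq) lam0) => [i|d|d].
  - by case: lam_niso; apply: iso_trans i Tnu.
  - constructor 1; apply: (inter _ _ Tnu d); first exact: n51_degenerates_n3.
    exact: n51_niso_n3.
  - constructor 2; apply: (inter _ _ Tnu d); first exact: n52_degenerates_n3.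
    exact: n52_niso_n3.
have {}Tnu := Tnu (lam2_neq0 hn).
have [x xx] := degenerates_lam2_square (lamT _ Tnu).
have [mu0 i0 a0] := exists_entry11 hn lam_nil xx.
have [[mu1 [i1 s1]]|nskew] :=
    pselect (exists mu, isomorphic lam mu /\ @form_skew K n hn mu != 0).
  have [mu2 i2 [a2 s2]] := exists_entry11_skew i0 i1 a0 s1.
  constructor 3; eexists; apply: (inter _ _ Tnu).
  - exact: degenerates_iso (iso_sym i2) (iso_refl _) (degenerates_L4 a2 s2).
  - exact: L4_degenerates_lam2.
  - exact: L4_niso_lam2.
have skew0 mu : isomorphic lam mu -> @form_skew K n hn mu = 0.
  by move=> i; apply: contrapT => /eqP s; apply: nskew; exists mu.
have [[mu1 [i1 d1]]|ndet] :=
    pselect (exists mu, isomorphic lam mu /\ @form_det K n hn mu != 0).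
  have [mu2 i2 [a2 d2]] := exists_entry11_det i0 i1 a0 d1.
  constructor 4; apply: (inter _ _ Tnu).
  - exact: degenerates_iso (iso_sym i2) (iso_refl _) (degenerates_L5 a2 (skew0 _ i2) d2).
  - exact: L5_degenerates_lam2.
  - exact: L5_niso_lam2.
have det0 mu : isomorphic lam mu -> @form_det K n hn mu = 0.
  by move=> i; apply: contrapT => /eqP s; apply: ndet; exists mu.
by case: lam_niso; apply: iso_trans (iso_lam2 lam_nil skew0 det0 xx) Tnu.
Qed.

End LevelTwo.

Theorem theorem4 (R : realType) (n : nat) (hn : (5 <= n)%N)
    (lam : alg R[i] n) (lam_nil : nilpotent_alg lam)
    (lam_level : has_level lam 2) :
  [\/ isomorphic lam n51, isomorphic lam n52,
      exists alpha : R[i], isomorphic lam (L4 alpha)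
    | isomorphic lam L5].
Proof. exact: (level_two_classification hn lam_nil lam_level). Qed.
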